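(* Any polynomial $f\in\mathcal A=\mathbb C[x_1,\dots,x_{26}]$ satisfying the system of partial differential equations $$E_{\bar\alpha}(f)=0\qquad\text{for all }\bar\alpha\in\Phi_{F_4}^+$$ must be a polynomial in $x_1,\zeta_1,\vartheta,\eta_1,\eta_2$. In particular, the elements $$\{x_1^{m_1}\zeta_1^{m_2}\vartheta^{m_3}\eta_1^{m_4}\eta_2^{m_5}\mid m_1,m_2,m_3,m_4,m_5\in\mathbb N\}$$ are linearly independent singular vectors, and any singular vector is a linear combination of those elements of this set that have the same weight as it. The weight of $x_1^{m_1}\zeta_1^{m_2}\vartheta^{m_3}\eta_1^{m_4}\eta_2^{m_5}$ is $m_3\lambda_3+(m_1+m_2)\lambda_4$.
   Context: Notation: $\mathbb N=\{0,1,2,\dots\}$; $\bar r=27-r$ for $1\le r\le 26$. All Lie algebras are over $\mathbb C$. The Lie algebra of type $E_6$. Let $\alpha_1,\dots,\alpha_6$ be the simple roots of $E_6$, with Dynkin diagram edges $1-3$, $3-4$, $4-5$, $5-6$, $2-4$. Let $Q=\sum_i\mathbb Z\alpha_i$ with symmetric bilinear form $(\alpha_i,\alpha_i)=2$, $(\alpha_i,\alpha_j)=-1$ if $i,j$ are adjacent and $0$ otherwise for $i\ne j$, and let $\Phi=\{\alpha\in Q\mid(\alpha,\alpha)=2\}$. Put $$F\Big(\sum_i k_i\alpha_i,\sum_j l_j\alpha_j\Big)=(-1)^{\sum_{i=1}^6k_il_i+k_1l_3+k_4l_2+k_3l_4+k_5l_4+k_6l_5}.$$ Let $H=\bigoplus_i\mathbb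 C\alpha_i$ (with the form extended bilinearly) and $\mathcal G^{E_6}=H\oplus\bigoplus_{\alpha\in\Phi}\mathbb CE_\alpha$, with bracket $[H,H]=0$, $[h,E_\alpha]=-[E_\alpha,h]=(h,\alpha)E_\alpha$, $[E_\alpha,E_{-\alpha}]=-\alpha$, and, for $\beta\neq-\alpha$, $[E_\alpha,E_\beta]=F(\alpha,\beta)E_{\alpha+\beta}$ if $\alpha+\beta\in\Phi$ and $0$ otherwise. Let $\sigma$ be the automorphism of $Q$ with $\sigma(\sum k_i\alpha_i)=k_6\alpha_1+k_2\alpha_2+k_5\alpha_3+k_4\alpha_4+k_3\alpha_5+k_1\alpha_6$. It extends linearly to $H$ and induces an automorphism $\hat\sigma$ of $\mathcal G^{E_6}$ of order 2 by $\hat\sigma(E_\alpha)=E_{\sigma(\alpha)}$ and $\hat\sigma|_H=\sigma$. The Lie algebra of type $F_4$ and its basic module. $\mathcal G^{F_4}=\{u\in\mathcal G^{E_6}\mid\hat\sigma(u)=u\}$ is the simple Lie algebra of type $F_4$, with Cartan subalgebra spanned by $h_1=\alpha_2$, $h_2=\alpha_4$, $h_3=\alpha_3+\alpha_5$, $h_4=\alpha_1+\alpha_6$; these are the simple coroots for the simple roots $\bar\alpha_1,\bar\alpha_2$ (long), $\bar\alpha_3,\bar\alpha_4$ (short). $\lambda_1,\dots,\lambda_4$ are the corresponding fundamental weights: $\lambda_i(h_j)=\delta_{ij}$. $\Phi_{F_4}^+$ is the set of 24 positive roots; the positive root vectors $E_{\bar\alpha}$, $\bar\alpha\in\Phi_{F_4}^+$,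 are the elements $E_\alpha$ for positive $\alpha\in\Phi$ with $\sigma(\alpha)=\alpha$, and $E_\alpha+E_{\sigma(\alpha)}$ for positive $\alpha\in\Phi$ with $\sigma(\alpha)\ne\alpha$ (one for each $\sigma$-orbit). The space $V=\{w\in\mathcal G^{E_6}\mid\hat\sigma(w)=-w\}$, with the adjoint action of $\mathcal G^{F_4}$, is the basic 26-dimensional irreducible module. It has basis $x_1,\dots,x_{26}$, where for $1\le r\le12$ $$x_r=E_{\beta_r}-E_{\sigma(\beta_r)},\qquad x_{27-r}=E_{-\beta_r}-E_{-\sigma(\beta_r)},$$ $\beta_1=\alpha_1+\alpha_2+2\alpha_3+2\alpha_4+\alpha_5+\alpha_6$, $\beta_2=\alpha_1+\alpha_2+2\alpha_3+2\alpha_4+\alpha_5$, $\beta_3=\alpha_1+\alpha_2+\alpha_3+2\alpha_4+\alpha_5$, $\beta_4=\alpha_1+\alpha_2+\alpha_3+\alpha_4+\alpha_5$, $\beta_5=\alpha_1+\alpha_2+\alpha_3+\alpha_4$, $\beta_6=\alpha_1+\alpha_3+\alpha_4+\alpha_5$, $\beta_7=\alpha_2+\alpha_3+\alpha_4$, $\beta_8=\alpha_1+\alpha_3+\alpha_4$, $\beta_9=\alpha_3+\alpha_4$, $\beta_{10}=\alpha_1+\alpha_3$, $\beta_{11}=\alpha_3$, $\beta_{12}=\alpha_1$, and $x_{13}=\alpha_1-\alpha_6$, $x_{14}=\alpha_3-\alpha_5$. The vector $x_1$ is a highest weight vector of $V$, of weight $\lambda_4$. The polynomial representation. $\mathcal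 A=\mathbb C[x_1,\dots,x_{26}]$ is the polynomial algebra in the $x_r$ treated as commuting variables; $\mathcal G^{F_4}$ acts on $\mathcal A$ by derivations extending its action on $V=\sum_r\mathbb Cx_r$ (so each element acts as a first-order linear differential operator with linear coefficients). A singular vector is a weight vector in $\mathcal A$ annihilated by all positive root vectors $E_{\bar\alpha}$, $\bar\alpha\in\Phi^+_{F_4}$. The special polynomials. $$\eta_1=3\sum_{r=1}^{12}x_rx_{\bar r}-x_{13}^2-x_{13}x_{14}-x_{14}^2,$$ $$\zeta_1=x_1(2x_{13}+x_{14})-3x_2x_{12}-3x_3x_{10}+3x_4x_8-3x_5x_6,$$ $$\vartheta=x_1(-x_2x_{13}+x_1x_{15}-x_3x_{11}+x_4x_9-x_6x_7)+x_2(x_2x_{12}+x_3x_{10}-x_4x_8+x_5x_6).$$ The polynomial $\zeta_1$ is a singular vector of weight $\lambda_4$, so it generates a submodule isomorphic to $V$; for $1\le r\le26$ let $\zeta_r$ be the image of $x_r$ under the unique $\mathcal G^{F_4}$-module isomorphism from $V$ onto this submodule sending $x_1$ to $\zeta_1$. Finally $$\eta_2=3\sum_{r=1}^{12}(\zeta_rx_{\bar r}+x_r\zeta_{\bar r})-2x_{13}\zeta_{13}-x_{13}\zeta_{14}-x_{14}\zeta_{13}-2x_{14}\zeta_{14}.$$ The polynomials $\eta_1,\eta_2$ are $\mathcal G^{F_4}$-invariant. *)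

(* Defs.v *)
From HB Require Import structures.
From mathcomp Require Import all_boot all_order all_fingroup all_algebra.
From mathcomp Require Import reals complex mpoly ring lra zify.

Set Implicit Arguments.
Unset Strict Implicit.
Unset Printing Implicit Defensive.

Import Order.TTheory GRing.Theory Num.Theory.
Local Open Scope ring_scope.

(* All families that are numbered from 1 on paper (alpha_i, beta_r, h_i,
   lambda_i, x_r, zeta_r) are functions of a natural number numbered from 1
   here as well; only the ordinals underneath ('I_6, 'I_26, 'I_4) start at 0. *)

Definition adjacent (i j : nat) : bool :=
  let edges := [:: (1, 3); (3, 4); (4, 5); (5, 6); (2, 4)]%N in
  ((i, j) \in edges) || ((j, i) \in edges).

Definition cartan (i j : 'I_6) : int :=
  if i == j then 2 else if adjacent i.+1 j.+1 then -1 else 0.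

(* Vectors are rows of coordinates on the simple roots; the form is used both
   on Q = 'rV[int]_6 and on H = 'rV[R[i]]_6. *)
Definition form (A : comNzRingType) (u v : 'rV[A]_6) : A :=
  \sum_(i < 6) \sum_(j < 6) (cartan i j)%:~R * u 0 i * v 0 j.

Definition coor (A : Type) (u : 'rV[A]_6) (i : nat) : A := u 0 (inord i.-1).

Definition latt (s : seq int) : 'rV[int]_6 := \row_(i < 6) s`_i.

Definition sigma_perm : 'S_6 :=
  (tperm (inord 0) (inord 5) * tperm (inord 2) (inord 4))%g.

Definition sigma (A : Type) (u : 'rV[A]_6) : 'rV[A]_6 := col_perm sigma_perm u.

Record root := Root {
  root_val :> 'rV[int]_6;
  _ : form root_val root_val == 2 }.

HB.instance Definition _ := [isSub for root_val].
HB.instance Definition _ := [Countable of root by <:].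

Lemma coorE (A : Type) (u : 'rV[A]_6) (i : 'I_6) : u 0 i = coor u i.+1.
Proof. by rewrite /coor; congr (u _ _); apply/val_inj; rewrite /= inordK. Qed.

Lemma formE (A : comNzRingType) (u v : 'rV[A]_6) :
  let k := coor u in let l := coor v in
  form u v =
    2 * (k 1%N * l 1%N + k 2%N * l 2%N + k 3%N * l 3%N
         + k 4%N * l 4%N + k 5%N * l 5%N + k 6%N * l 6%N)
    - (k 1%N * l 3%N + k 3%N * l 1%N) - (k 3%N * l 4%N + k 4%N * l 3%N)
    - (k 4%N * l 5%N + k 5%N * l 4%N) - (k 5%N * l 6%N + k 6%N * l 5%N)
    - (k 2%N * l 4%N + k 4%N * l 2%N) :> A.
Proof.
rewrite /form; under eq_bigr => i _ do under eq_bigr => j _ do rewrite !coorE.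
rewrite !big_ord_recr !big_ord0 /= /cartan /=.
by ring.
Qed.

(* The form is positive definite, so Phi is finite: all the coordinates of a
   root are between -3 and 3. *)
Lemma root_bound (a : root) (i : 'I_6) : -3 <= root_val a 0 i <= 3.
Proof.
case: a => u /= /eqP; rewrite formE /= coorE.
move: (coor u) => k Q.
have sq (x : int) : x ^+ 2 <= 12 -> -3 <= x <= 3 by nia.
set k1 := k 1%N in Q *; set k2 := k 2%N in Q *; set k3 := k 3%N in Q *.
set k4 := k 4%N in Q *; set k5 := k 5%N in Q *; set k6 := k 6%N in Q *.
have p1 := sqr_ge0 (2 * k6 - k5); have p2 := sqr_ge0 (2 * k2 - k4).
have p3 := sqr_ge0 (3 * k5 - 2 * k4); have p4 := sqr_ge0 (5 * k4 - 6 * k3).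
have p5 := sqr_ge0 (4 * k3 - 5 * k1); have p6 := sqr_ge0 (2 * k1 - k3).
have p7 := sqr_ge0 (3 * k3 - 2 * k4); have p8 := sqr_ge0 (2 * k4 - 3 * k2).
have p9 := sqr_ge0 (5 * k4 - 6 * k5); have p0 := sqr_ge0 (4 * k5 - 5 * k6).
case: i => -[|[|[|[|[|[|]]]]]] //= _; apply: sq;
  rewrite -?/k1 -?/k2 -?/k3 -?/k4 -?/k5 -?/k6; lra.
Qed.


Definition root_code (a : root) : {ffun 'I_6 -> 'I_7} :=
  [ffun i => inord (absz (root_val a 0 i + 3))].
Definition root_decode (c : {ffun 'I_6 -> 'I_7}) : option root :=
  insub (\row_i ((c i : nat)%:Z - 3)).

Lemma root_codeK : pcancel root_code root_decode.
Proof.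
move=> a; rewrite /root_decode.
suff -> : \row_i ((root_code a i : nat)%:Z - 3) = \val a by rewrite valK.
apply/rowP => i; rewrite mxE ffunE.
have /= := root_bound a i; move: (root_val a 0 i) => x xb.
rewrite inordK; lia.
Qed.

HB.instance Definition _ : isFinite root := PCanIsFinite root_codeK.

Lemma sigmaE (A : Type) (u : 'rV[A]_6) :
  [/\ coor (sigma u) 1 = coor u 6, coor (sigma u) 2 = coor u 2,
      coor (sigma u) 3 = coor u 5, coor (sigma u) 4 = coor u 4 &
      coor (sigma u) 5 = coor u 3 /\ coor (sigma u) 6 = coor u 1].
Proof.
rewrite /coor !mxE !permM /=.
do !split; congr (u _ _); rewrite !permE /= -!val_eqE /= ?inordK //=;
  rewrite -!val_eqE /= ?inordK //=.
Qed.

Lemma form_sigma (A : comNzRingType) (u v : 'rV[A]_6) :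
  form (sigma u) (sigma v) = form u v.
Proof.
rewrite !formE /=.
have [-> -> -> -> [-> ->]] := sigmaE u; have [-> -> -> -> [-> ->]] := sigmaE v.
by ring.
Qed.

Lemma sigmaK (A : Type) : involutive (@sigma A).
Proof.
move=> u; apply/rowP => i; rewrite !coorE.
have [e1 e2 e3 e4 [e5 e6]] := sigmaE u.
have [f1 f2 f3 f4 [f5 f6]] := sigmaE (sigma u).
by case: i => -[|[|[|[|[|[|]]]]]] //= _; rewrite ?f1 ?f2 ?f3 ?f4 ?f5 ?f6.
Qed.

Lemma sigmaD (A : nmodType) (u v : 'rV[A]_6) : sigma (u + v) = sigma u + sigma v.
Proof. by apply/rowP => i; rewrite !mxE. Qed.

Lemma sigmaN (A : zmodType) (u : 'rV[A]_6) : sigma (- u) = - sigma u.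
Proof. by apply/rowP => i; rewrite !mxE. Qed.

Definition root_sigma (a : root) : root :=
  Root (etrans (congr1 (eq_op^~ 2) (form_sigma (root_val a) (root_val a)))
               (valP a)).

Lemma root_sigmaK : involutive root_sigma.
Proof. by move=> a; apply: val_inj; rewrite /= sigmaK. Qed.

(* The exponent is an integer, and z ^ n is the integer power. *)
Definition F (A : unitRingType) (a b : 'rV[int]_6) : A :=
  let k := coor a in let l := coor b in
  (-1) ^ (\sum_(i < 6) a 0 i * b 0 i
          + k 1%N * l 3%N + k 4%N * l 2%N + k 3%N * l 4%N
          + k 5%N * l 4%N + k 6%N * l 5%N).

Lemma F_sigma (A : unitRingType) (a b : 'rV[int]_6) :
  F A (sigma a) (sigma b) = F A a b.
Proof.
rewrite /F !big_ord_recr !big_ord0 /= !coorE /=.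
have [-> -> -> -> [-> ->]] := sigmaE a; have [-> -> -> -> [-> ->]] := sigmaE b.
by congr (_ ^ _); ring.
Qed.

(* (h, c) stands for h + \sum_(a in Phi) c(a) E_a. *)
Notation E6 R := ('rV[R[i]]_6 * {ffun root -> R[i]^o})%type.

Section E6Theory.
Variable R : realType.
Local Notation C := R[i].

Definition inH (h : 'rV[C]_6) : E6 R := (h, 0 : {ffun root -> C^o}).

Definition toH (q : 'rV[int]_6) : 'rV[C]_6 := map_mx intr q.

(* E q is the root vector of q when q is a root, and 0 otherwise. *)
Definition E (q : 'rV[int]_6) : E6 R :=
  (0, [ffun a => (root_val a == q)%:R] : {ffun root -> C^o}).

Definition bracketEE (a b : root) : E6 R :=
  let a' := root_val a in let b' := root_val b in
  if b' == - a' then inH (toH (- a'))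
  else if form (a' + b') (a' + b') == 2 then F C a' b' *: E (a' + b')
  else 0.

(* Bilinear extensions of [h, E_a] = (h, a) E_a and of the [E_a, E_b];
   [H, H] = 0 contributes nothing to bracket. *)
Definition bracketHE (u v : E6 R) : E6 R :=
  \sum_(a : root) (form u.1 (toH (root_val a)) * v.2 a) *: E (root_val a).

Definition bracketEE_sum (u v : E6 R) : E6 R :=
  \sum_(a : root) \sum_(b : root) (u.2 a * v.2 b) *: bracketEE a b.

Definition bracket (u v : E6 R) : E6 R :=
  bracketHE u v - bracketHE v u + bracketEE_sum u v.

Definition sigma_hat (u : E6 R) : E6 R :=
  inH (sigma u.1) + \sum_(a : root) u.2 a *: E (sigma (root_val a)).

Lemma sigma_hat_linear : linear sigma_hat.
Proof.
move=> c u v; rewrite /sigma_hat scalerDr addrACA; congr (_ + _).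
  apply: injective_projections => /=; first by rewrite /sigma linearP.
  by rewrite scaler0 addr0.
rewrite scaler_sumr -big_split /=; apply: eq_bigr => a _.
by rewrite scalerA -scalerDl ffunE ffunE.
Qed.

HB.instance Definition _ :=
  GRing.isLinear.Build C (E6 R) (E6 R) _ sigma_hat sigma_hat_linear.

Lemma sigma_hatZ c (u : E6 R) : sigma_hat (c *: u) = c *: sigma_hat u.
Proof. exact: linearZ_LR. Qed.

Lemma sigma_hatD (u v : E6 R) : sigma_hat (u + v) = sigma_hat u + sigma_hat v.
Proof. exact: linearD. Qed.

Lemma sigma_hatB (u v : E6 R) : sigma_hat (u - v) = sigma_hat u - sigma_hat v.
Proof. exact: linearB. Qed.

Lemma sigma_hat_sum (f : root -> E6 R) :
  sigma_hat (\sum_a f a) = \sum_a sigma_hat (f a).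
Proof. exact: linear_sum. Qed.

Lemma sigma_hatH (h : 'rV[C]_6) : sigma_hat (inH h) = inH (sigma h).
Proof.
by rewrite /sigma_hat /= big1 ?addr0 // => a _; rewrite ffunE scale0r.
Qed.

Lemma toH_sigma (q : 'rV[int]_6) : toH (sigma q) = sigma (toH q).
Proof. by rewrite /toH /sigma map_col_perm. Qed.

Lemma sigma_hatE (q : 'rV[int]_6) : sigma_hat (E q) = E (sigma q).
Proof.
rewrite /sigma_hat /= /inH /sigma linear0 add0r -/(sigma _).
have [a aq | nq] := pickP (fun a : root => root_val a == q).
  rewrite (bigD1 a) //= ffunE aq scale1r big1 ?addr0.
    by rewrite -(eqP aq).
  move=> b /negbTE nba; rewrite ffunE -(eqP aq).
  by rewrite -[root_val b == _]/(b == a) nba scale0r.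
rewrite big1; last by move=> a _; rewrite ffunE nq scale0r.
rewrite /E; congr (_, _); apply/ffunP => a; rewrite !ffunE.
suff -> : (root_val a == sigma q) = false by [].
have := nq (root_sigma a); rewrite /= => <-.
by rewrite -[q in RHS](sigmaK q) (inj_eq (can_inj (@sigmaK _))).
Qed.

Lemma sigma_hat_bracketEE (a b : root) :
  sigma_hat (bracketEE a b) = bracketEE (root_sigma a) (root_sigma b).
Proof.
rewrite /bracketEE /= -!sigmaN -!sigmaD form_sigma F_sigma.
rewrite (inj_eq (can_inj (@sigmaK _))).
move: (root_val b == _) (form _ _ == _) => [] [].
- by rewrite sigma_hatH toH_sigma.
- by rewrite sigma_hatH toH_sigma.
- by rewrite sigma_hatZ sigma_hatE.
exact: linear0.
Qed.

Lemma sigma_hat1 (u : E6 R) : (sigma_hat u).1 = sigma u.1.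
Proof.
rewrite /sigma_hat /= raddf_sum /= big1 ?addr0 // => a _.
by rewrite scaler0.
Qed.

Lemma sigma_hat2 (u : E6 R) (a : root) : (sigma_hat u).2 a = u.2 (root_sigma a).
Proof.
rewrite /sigma_hat /= raddf_sum /= add0r sum_ffunE.
transitivity (\sum_b (u.2 b : C) * (root_val a == sigma (root_val b))%:R).
  by apply: eq_bigr => b _; rewrite ffunE ffunE.
rewrite (bigD1 (root_sigma a)) //= sigmaK eqxx mulr1 big1 ?addr0 // => b nb.
suff -> : (root_val a == sigma (root_val b)) = false by exact: mulr0.
apply: contraNF nb => /eqP e; apply/eqP; apply: val_inj.
by rewrite /= e sigmaK.
Qed.

Lemma sigma_hat_bracketHE (u v : E6 R) :
  sigma_hat (bracketHE u v) = bracketHE (sigma_hat u) (sigma_hat v).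
Proof.
rewrite /bracketHE sigma_hat_sum [RHS](reindex_inj (can_inj root_sigmaK)).
apply: eq_bigr => a _; rewrite sigma_hat1 sigma_hat2 root_sigmaK.
by rewrite sigma_hatZ sigma_hatE toH_sigma form_sigma.
Qed.

Lemma sigma_hat_bracketEE_sum (u v : E6 R) :
  sigma_hat (bracketEE_sum u v) = bracketEE_sum (sigma_hat u) (sigma_hat v).
Proof.
have inv := can_inj root_sigmaK.
rewrite /bracketEE_sum sigma_hat_sum [RHS](reindex_inj inv).
apply: eq_bigr => a _; rewrite sigma_hat_sum [RHS](reindex_inj inv).
apply: eq_bigr => b _; rewrite !sigma_hat2 !root_sigmaK.
by rewrite sigma_hatZ sigma_hat_bracketEE.
Qed.

Lemma sigma_hat_bracket (u v : E6 R) :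
  sigma_hat (bracket u v) = bracket (sigma_hat u) (sigma_hat v).
Proof.
rewrite /bracket (sigma_hatD (_ - _) _) (sigma_hatB (bracketHE _ _) _).
have e1 := sigma_hat_bracketHE u v; have e2 := sigma_hat_bracketHE v u.
have e3 := sigma_hat_bracketEE_sum u v.
exact: (congr2 _ (congr2 _ e1 (congr1 _ e2)) e3).
Qed.

Lemma bracketNr (u v : E6 R) : bracket u (- v) = - bracket u v.
Proof.
have e1 : bracketHE u (- v) = - bracketHE u v.
  rewrite /bracketHE -sumrN; apply: eq_bigr => a _.
  by rewrite -scaleNr -mulrN /= ffunE.
have e2 : bracketHE (- v) u = - bracketHE v u.
  rewrite /bracketHE -sumrN; apply: eq_bigr => a _.
  rewrite -scaleNr -mulNr; congr (_ * _ *: _).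
  rewrite /form -sumrN; apply: eq_bigr => i _; rewrite -sumrN.
  by apply: eq_bigr => j _; rewrite /= !mxE mulrN mulNr.
have e3 : bracketEE_sum u (- v) = - bracketEE_sum u v.
  rewrite /bracketEE_sum -sumrN; apply: eq_bigr => a _.
  rewrite -sumrN; apply: eq_bigr => b _.
  by rewrite -scaleNr -mulrN /= ffunE.
by rewrite /bracket e1 e2 e3 !opprD.
Qed.

Definition GF4 : {vspace E6 R} := lker (linfun sigma_hat - \1)%VF.

Definition V26 : {vspace E6 R} := lker (linfun sigma_hat + \1)%VF.

Lemma GF4P (u : E6 R) : (u \in GF4) = (sigma_hat u == u).
Proof. by rewrite memv_ker add_lfunE ?opp_lfunE lfunE id_lfunE subr_eq0. Qed.

Lemma V26P (w : E6 R) : (w \in V26) = (sigma_hat w == - w).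
Proof. by rewrite memv_ker add_lfunE ?opp_lfunE lfunE id_lfunE addr_eq0. Qed.

Lemma bracket_GF4_V26 (u w : E6 R) : u \in GF4 -> w \in V26 -> bracket u w \in V26.
Proof.
rewrite GF4P !V26P sigma_hat_bracket => /eqP -> /eqP ->.
by rewrite bracketNr.
Qed.

Definition beta (r : nat) : 'rV[int]_6 :=
  latt (nth [::] [::
    [:: 1; 1; 2; 2; 1; 1]; [:: 1; 1; 2; 2; 1; 0]; [:: 1; 1; 1; 2; 1; 0];
    [:: 1; 1; 1; 1; 1; 0]; [:: 1; 1; 1; 1; 0; 0]; [:: 1; 0; 1; 1; 1; 0];
    [:: 0; 1; 1; 1; 0; 0]; [:: 1; 0; 1; 1; 0; 0]; [:: 0; 0; 1; 1; 0; 0];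
    [:: 1; 0; 1; 0; 0; 0]; [:: 0; 0; 1; 0; 0; 0]; [:: 1; 0; 0; 0; 0; 0]]
    r.-1).

Definition xvec (r : nat) : E6 R :=
  if (r <= 12)%N then E (beta r) - E (sigma (beta r))
  else if r == 13%N then inH (toH (latt [:: 1; 0; 0; 0; 0; -1]))
  else if r == 14%N then inH (toH (latt [:: 0; 0; 1; 0; -1; 0]))
  else E (- beta (27 - r)) - E (- sigma (beta (27 - r))).

Definition xbasis : 26.-tuple (E6 R) := [tuple xvec i.+1 | i < 26].

Definition coroot (i : nat) : E6 R :=
  inH (toH (latt (nth [::] [::
    [:: 0; 1; 0; 0; 0; 0]; [:: 0; 0; 0; 1; 0; 0];
    [:: 0; 0; 1; 0; 1; 0]; [:: 1; 0; 0; 0; 0; 1]] i.-1))).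

Definition coroots : 4.-tuple (E6 R) := [tuple coroot i.+1 | i < 4].

Definition cartanF4 : {vspace E6 R} := <<coroots>>%VS.

(* Weights are linear forms on the Cartan subalgebra; the fundamental weights
   are the basis dual to the simple coroots. *)
Notation weight := 'Hom(subvs_of cartanF4, C^o).

Definition lambda (i : nat) : weight :=
  linfun (fun h : subvs_of cartanF4 =>
            coord coroots (inord i.-1) (vsval h) : C^o).

Definition positive (a : 'rV[int]_6) : bool := [forall i, 0 <= a 0 i].

(* The positive root vectors of F4 are the elements pos_rootvec a for positive
   roots a of E6; a and sigma a give the same one. *)
Definition pos_rootvec (a : 'rV[int]_6) : E6 R :=
  if sigma a == a then E a else E a + E (sigma a).

Local Notation A := {mpoly C[26]}.

Definition X (r : nat) : A := 'X_(inord r.-1).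

(* V26 identified with the linear part of A: x_r is the r-th variable. *)
Definition linpol (w : E6 R) : A := \sum_(r < 26) coord xbasis r w *: 'X_r.

(* The derivation of A that extends w |-> [u, w] on V. *)
Definition act (u : E6 R) (f : A) : A :=
  \sum_(r < 26) linpol (bracket u xbasis`_r) * f^`M(r).

Definition killed_by_positive (f : A) : Prop :=
  forall a : root, positive (root_val a) -> act (pos_rootvec (root_val a)) f = 0.

Definition weight_vector (mu : weight) (f : A) : Prop :=
  f != 0 /\ forall h : subvs_of cartanF4, act (vsval h) f = (mu h : C) *: f.

Definition singular_of_weight (mu : weight) (f : A) : Prop :=
  weight_vector mu f /\ killed_by_positive f.

Definition submodule (S : A -> Prop) : Prop :=
  [/\ S 0, forall (c : C) f g, S f -> S g -> S (c *: f + g) &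
      forall u f, u \in GF4 -> S f -> S (act u f)].

Definition generated_submodule (z f : A) : Prop :=
  forall S : A -> Prop, submodule S -> S z -> S f.

(* The map phi is an isomorphism of GF4-modules from V onto the submodule
   generated by z, and it sends x_1 to z. The projection vsproj onto V is
   harmless: V is stable under GF4 (bracket_GF4_V26). *)
Definition isom_onto_generated (z : A) (phi : {linear subvs_of V26 -> A}) : Prop :=
  [/\ injective phi,
      forall u w, u \in GF4 ->
        phi (vsproj V26 (bracket u (vsval w))) = act u (phi w),
      forall f, generated_submodule z f <-> exists w, f = phi w &
      phi (vsproj V26 (xvec 1)) = z].

Definition eta1 : A :=
  3 * (\sum_(1 <= r < 13) X r * X (27 - r))
  - X 13 ^+ 2 - X 13 * X 14 - X 14 ^+ 2.

Definition zeta1 : A :=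
  X 1 * (2 * X 13 + X 14) - 3 * X 2 * X 12 - 3 * X 3 * X 10
  + 3 * X 4 * X 8 - 3 * X 5 * X 6.

Definition vartheta : A :=
  X 1 * (- X 2 * X 13 + X 1 * X 15 - X 3 * X 11 + X 4 * X 9 - X 6 * X 7)
  + X 2 * (X 2 * X 12 + X 3 * X 10 - X 4 * X 8 + X 5 * X 6).

Definition zeta (phi : {linear subvs_of V26 -> A}) (r : nat) : A :=
  phi (vsproj V26 (xvec r)).

Definition eta2 (phi : {linear subvs_of V26 -> A}) : A :=
  let z := zeta phi in
  3 * (\sum_(1 <= r < 13) (z r * X (27 - r) + X r * z (27 - r)%N))
  - 2 * X 13 * z 13%N - X 13 * z 14%N - X 14 * z 13%N - 2 * X 14 * z 14%N.

Definition generators (phi : {linear subvs_of V26 -> A}) : 5.-tuple A :=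
  [tuple X 1; zeta1; vartheta; eta1; eta2 phi].

Definition gen_monomial (phi : {linear subvs_of V26 -> A})
    (m : nat * nat * nat * nat * nat) : A :=
  let: (m1, m2, m3, m4, m5) := m in
  X 1 ^+ m1 * zeta1 ^+ m2 * vartheta ^+ m3 * eta1 ^+ m4 * eta2 phi ^+ m5.

End E6Theory.

Notation weight R := 'Hom(subvs_of (cartanF4 R), R[i]^o).

Definition linearly_independent (K : fieldType) (W : lmodType K) (I : eqType)
    (v : I -> W) : Prop :=
  forall (s : seq I) (c : I -> K), uniq s ->
    \sum_(i <- s) c i *: v i = 0 -> forall i, i \in s -> c i = 0.

(* Main.v *)
From HB Require Import structures.
From mathcomp Require Import all_boot all_order all_algebra.
From mathcomp Require Import reals complex mpoly ring zify.
Require Import Defs.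

Set Implicit Arguments.
Unset Strict Implicit.
Unset Printing Implicit Defensive.

Import Order.TTheory GRing.Theory Num.Theory.
Local Open Scope ring_scope.

(** Why the theorem holds.  A polynomial killed by the positive root vectors is
    constant along the flows t |-> exp (t u) v of these (nilpotent) linear vector
    fields ([flow_invariant]).  Starting from a point with x_1 <> 0, fifteen such
    flows, one for each positive root that moves some weight of V to the highest
    weight, clear in turn the coordinates x_2, ..., x_12, x_14, x_16, x_18, x_20.
    On the points reached, vartheta is x_1^2 x_15; if it does not vanish, six more
    flows clear x_17, x_19, x_21, ..., x_24 with x_15 as pivot ([to_slice]).  So an
    invariant polynomial is determined by its restriction to the slice with
    coordinates x_1, x_13, x_15, x_25, x_26.  There the generators become

      x_1,  2 x_1 x_13,  x_1^2 x_15,  3 x_1 x_26 - x_13^2,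
      27 x_1 x_15 x_25 + 18 x_1 x_13 x_26 + 2 x_13^3,

    and these can be solved for the five coordinates with only x_1 and vartheta in
    the denominators.  Hence f (x_1 vartheta)^N is a polynomial in the generators
    for some N ([localized_generation]), and the generators take all values with
    x_1 and vartheta nonzero, so they are algebraically independent.

    The denominators cancel one factor at a time ([reached_div]): if a generator
    g_i divides P(g_1, ..., g_5), and the other generators are algebraically
    independent on the zero locus of g_i, then P is divisible by its i-th variable.
    This independence is seen on two explicit families of points, one with
    vartheta = 0 ([reached_vartheta0]) and one with x_1 = 0 ([reached_x0]).

    The weights of the generators are read off from the simple coroots; as distinct
    monomials are linearly independent, a weight vector only involves monomials of
    its own weight.

    The remaining input is finite: the matrices of the root vectors on V, the
    polynomials zeta_r, the invariance of the generators and the effect of each of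
    the 21 flows.  It is obtained by computing with integer combinations of root
    vectors and of monomials, through a bracket proved to agree with that of E6
    ([bracket_lc], [act_lc_mon]).  As phi is only given as an isomorphism, the
    zeta_r are recovered from zeta_1 = phi(x_1) by applying negative root vectors
    ([zeta_lc]). *)

(** * Polynomials in characteristic zero *)

Section Polynomials.
Variable K : numFieldType.

Lemma mpoly_alg_ind (n : nat) (P : {mpoly K[n]} -> Prop) :
  (forall c, P c%:MP) -> (forall i, P 'X_i) ->
  (forall f g, P f -> P g -> P (f + g)) ->
  (forall f g, P f -> P g -> P (f * g)) -> forall f, P f.
Proof.
move=> PC PX PD PM; elim/mpolyind => [|c m p _ _ Pp]; first exact: (PC 0).
apply: PD Pp; rewrite -mul_mpolyC mpolyXE_id.
apply: (PM) => //; elim/big_ind: _ => [||i _]; [exact: (PC 1) | exact: PM | ].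
by elim: (m i) => [|k IH]; [rewrite expr0; exact: (PC 1) | rewrite exprS; exact: PM].
Qed.

Lemma mderivXU (n : nat) (i j : 'I_n) :
  ('X_j)^`M(i) = (i == j)%:R :> {mpoly K[n]}.
Proof.
rewrite mderivX mnm1E eq_sym; case: eqP => [->|_]; last by rewrite scale0r.
rewrite scale1r -[RHS]mpolyX0; congr 'X_[_].
by apply/mnmP => k; rewrite mnmBE mnm0E subnn.
Qed.

(** The chain rule along a polynomial curve; q is the composite of f and p, given
    through its values and the values of its derivative. *)
Lemma mpoly_along_curve (n : nat) (f : {mpoly K[n]}) (p : 'I_n -> {poly K}) :
  exists q : {poly K}, forall t,
    q.[t] = f.@[fun i => (p i).[t]] /\
    q^`().[t] = \sum_i f^`M(i).@[fun i => (p i).[t]] * (p i)^`().[t].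
Proof.
elim/mpoly_alg_ind: f => [c|i|f g [q1 H1] [q2 H2]|f g [q1 H1] [q2 H2]].
- exists c%:P => t; rewrite mevalC hornerC derivC horner0; split=> //.
  by rewrite big1 // => i _; rewrite mderivC meval0 mul0r.
- exists (p i) => t; rewrite mevalXU; split=> //.
  rewrite (bigD1 i) //= mderivXU eqxx meval1 mul1r big1 ?addr0 // => j ji.
  by rewrite mderivXU (negbTE ji) meval0 mul0r.
- exists (q1 + q2) => t; have [e1 d1] := H1 t; have [e2 d2] := H2 t.
  rewrite hornerD mevalD e1 e2; split=> //.
  rewrite derivD hornerD d1 d2 -big_split /=.
  by apply: eq_bigr => i _; rewrite mderivD mevalD mulrDl.
exists (q1 * q2) => t; have [e1 d1] := H1 t; have [e2 d2] := H2 t.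
rewrite hornerM mevalM e1 e2; split=> //.
rewrite derivM hornerD !hornerM d1 d2 e1 e2 mulr_suml mulr_sumr -big_split /=.
by apply: eq_bigr => i _; rewrite mderivM mevalD !mevalM; ring.
Qed.

Lemma poly_vanish (q : {poly K}) : (forall t, q.[t] = 0) -> q = 0.
Proof.
move=> q0; apply/eqP; apply: contraT => /max_poly_roots.
move=> /(_ [seq i%:R | i <- iota 0 (size q)]).
rewrite size_map size_iota ltnn => -> //.
  by apply/allP => t _; rewrite rootE q0.
by rewrite map_inj_uniq ?iota_uniq // => i j /eqP; rewrite eqr_nat => /eqP.
Qed.

Lemma poly_deriv0_const (q : {poly K}) :
  (forall t, q^`().[t] = 0) -> forall s t, q.[s] = q.[t].
Proof.
move=> /poly_vanish q'0 s t; suff -> : q = (q`_0)%:P by rewrite !hornerC.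
apply/polyP => -[|i]; rewrite coefC //=.
have /eqP := congr1 (fun p : {poly K} => p`_i) q'0.
by rewrite coef_deriv coef0 mulrn_eq0 /= => /eqP.
Qed.

Lemma mnm_neq0_witness (n : nat) (m : 'X_{1..n}) :
  m != 0%MM -> exists i, m i != 0%N.
Proof.
move=> m0; apply/existsP; rewrite -negb_forall; apply: contraNN m0 => /forallP k0.
by apply/eqP/mnmP => i; rewrite mnm0E; apply/eqP.
Qed.

(** The partial derivatives of f vanish everywhere too, by the chain rule along the
    coordinate lines; the coefficient of m is, up to a nonzero integer, the value at
    0 of an iterated derivative. *)
Lemma mpoly_vanish (n : nat) (f : {mpoly K[n]}) : (forall v, f.@[v] = 0) -> f = 0.
Proof.
have dvan (g : {mpoly K[n]}) i :
    (forall v, g.@[v] = 0) -> forall v, g^`M(i).@[v] = 0.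
  move=> g0 v.
  have [q Hq] := mpoly_along_curve g (fun j => (v j)%:P + (j == i)%:R *: 'X).
  have q0 : q = 0 by apply: poly_vanish => t; have [-> _] := Hq t.
  have [_] := Hq 0; rewrite q0 deriv0 horner0 (bigD1 i) //= big1 ?addr0.
    rewrite eqxx scale1r derivD derivC derivX add0r hornerC mulr1 => /esym.
    by under meval_eq => j do rewrite hornerD hornerC hornerZ hornerX mulr0 addr0.
  move=> j ji; rewrite (negbTE ji) scale0r derivD derivC deriv0 addr0 horner0.
  by rewrite mulr0.
move=> f0; apply/mpolyP => m; rewrite mcoeff0.
move En: (mdeg m) => d; elim: d m En f f0 => [|d IH] m.
  move/eqP; rewrite mdeg_eq0 => /eqP -> f /(_ (fun _ => 0)).
  rewrite mevalE => e; rewrite -[RHS]e; symmetry.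
  have monom0 (k : 'X_{1..n}) : k != 0%MM -> \prod_i (0 : K) ^+ k i = 0.
    by move=> /mnm_neq0_witness[i ki]; rewrite (bigD1 i) //= expr0n (negbTE ki) mul0r.
  have [m0|m0] := boolP (0%MM \in msupp f); last first.
    rewrite (memN_msupp_eq0 m0) big_seq big1 // => k kf.
    by rewrite monom0 ?mulr0 //; apply: contraNneq m0 => <-.
  rewrite (bigD1_seq 0%MM) ?msupp_uniq //= big1 ?mulr1 => [|i _]; last first.
    by rewrite mnm0E expr0.
  by rewrite big1 ?addr0 // => k k0; rewrite monom0 ?mulr0.
move=> dm f f0.
have [i mi] : exists i, m i != 0%N.
  by apply: mnm_neq0_witness; rewrite -mdeg_eq0 dm.
have e : (m - U_(i) + U_(i))%MM = m.
  by apply: submK; apply/mnm_lepP => j; rewrite mnm1E; case: eqP => // <-; rewrite lt0n.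
have /IH /(_ _ (dvan _ i f0)) : mdeg (m - U_(i)) = d.
  by apply/eqP; rewrite -eqSS -dm -{2}e mdegD mdeg1 addn1.
by rewrite mcoeff_deriv e => /eqP; rewrite mulrn_eq0 => /eqP.
Qed.

Lemma mpoly_vanish_off (n : nat) (f d : {mpoly K[n]}) :
  d != 0 -> (forall v, d.@[v] != 0 -> f.@[v] = 0) -> f = 0.
Proof.
move=> d0 H; apply/eqP; rewrite -(inj_eq (mulfI d0)) mulr0; apply/eqP.
apply: mpoly_vanish => v; rewrite mevalM.
by have [->|/H ->] := eqVneq d.@[v] 0; rewrite ?mul0r ?mulr0.
Qed.

Lemma meval_comp (n k : nat) (P : {mpoly K[n]}) (g : n.-tuple {mpoly K[k]}) v :
  (P \mPo g).@[v] = P.@[fun i => (tnth g i).@[v]].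
Proof.
elim/mpoly_alg_ind: P => [c|i|p q IHp IHq|p q IHp IHq].
- by rewrite comp_mpolyC !mevalC.
- by rewrite comp_mpolyXU mevalXU (tnth_nth 0).
- by rewrite comp_mpolyD !mevalD IHp IHq.
by rewrite rmorphM /= !mevalM IHp IHq.
Qed.

(** Division with remainder by a variable; the remainder is the substitution of 0
    for that variable. *)
Lemma mpoly_split_X (n : nat) (i : 'I_n) (P : {mpoly K[n]}) :
  exists P1, P = P \mPo [tuple if j == i then 0 else 'X_j | j < n] + 'X_i * P1.
Proof.
elim/mpoly_alg_ind: P => [c|j|p q [p1 IHp] [q1 IHq]|p q [p1 IHp] [q1 IHq]].
- by exists 0; rewrite comp_mpolyC mulr0 addr0.
- exists (j == i)%:R; rewrite comp_mpolyXU -tnth_nth tnth_mktuple.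
  by case: eqP => [->|_]; rewrite ?mulr1 ?mulr0 ?add0r ?addr0.
- by exists (p1 + q1); rewrite comp_mpolyD {1}IHp {1}IHq; ring.
rewrite rmorphM /=.
set p0 := (p \mPo _) in IHp *; set q0 := (q \mPo _) in IHq *.
by exists (p0 * q1 + p1 * q0 + 'X_i * p1 * q1); rewrite {1}IHp {1}IHq; ring.
Qed.

(** * Polynomials in the members of a family *)

Section Reach.
Variables (n k : nat) (g : n.-tuple {mpoly K[k]}).

Definition reached (c : 'I_n -> K) :=
  exists v, forall i, (tnth g i).@[v] = c i.

Lemma coordX_neq0 (i : 'I_n) : 'X_i != 0 :> {mpoly K[n]}.
Proof. by rewrite -msize_poly_eq0 msizeX. Qed.

Lemma prodX_neq0 (J : pred 'I_n) : \prod_(j | J j) 'X_j != 0 :> {mpoly K[n]}.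
Proof. by apply/prodf_neq0 => j _; exact: coordX_neq0. Qed.

Lemma meval_prodX (J : pred 'I_n) c :
  (\prod_(j | J j) 'X_j : {mpoly K[n]}).@[c] != 0 -> forall j, J j -> c j != 0.
Proof.
move=> H j Jj; apply: contraNneq H => cj.
by rewrite (bigD1 j) //= mevalM mevalXU cj mul0r.
Qed.

(** A relation between the g_i vanishes at all the values that they take. *)
Lemma reached_indep (P : {mpoly K[n]}) :
  (forall c, (forall j, c j != 0) -> reached c) -> P \mPo g = 0 -> P = 0.
Proof.
move=> H Pg; apply: (mpoly_vanish_off (prodX_neq0 predT)) => c /meval_prodX c0.
have [|v Hv] := H c; first by move=> j; apply: c0.
by have := meval_comp P g v; rewrite Pg meval0 (meval_eq _ Hv) => <-.
Qed.

(** The remainder of P modulo X_i vanishes at the values that the g_j take on the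
    zero locus of g_i, because g_i divides P(g); these values are dense in the
    hyperplane X_i = 0, so the remainder is zero and g_i can be cancelled. *)
Lemma reached_div (i : 'I_n) (P : {mpoly K[n]}) (f : {mpoly K[k]}) :
  tnth g i != 0 ->
  (forall c, c i = 0 -> (forall j, j != i -> c j != 0) -> reached c) ->
  tnth g i * f = P \mPo g -> exists P', f = P' \mPo g.
Proof.
move=> gi0 H e; have [P1 eP] := mpoly_split_X i P; exists P1.
suff P0 : P \mPo [tuple if j == i then 0 else 'X_j | j < n] = 0.
  apply: (mulfI gi0); rewrite e eP P0 add0r rmorphM /= comp_mpolyXU.
  by rewrite -tnth_nth.
apply: (mpoly_vanish_off (prodX_neq0 (predC1 i))) => c /meval_prodX c0.
pose c' j := if j == i then 0 else c j.
have [||v Hv] := H c'; first by rewrite /c' eqxx.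
  by move=> j ji; rewrite /c' (negbTE ji); apply: c0.
rewrite meval_comp (meval_eq _ (v2 := c')); last first.
  move=> j; rewrite tnth_mktuple /c'; case: eqP => _; first by rewrite meval0.
  by rewrite mevalXU.
rewrite -(meval_eq _ Hv) -meval_comp -e mevalM Hv /c' eqxx mul0r //.
Qed.

End Reach.

(** * Flows of nilpotent linear vector fields *)

Section Flow.
Variables (n : nat) (L : 'I_n -> 'I_n -> K).

Definition linfield (f : {mpoly K[n]}) : {mpoly K[n]} :=
  \sum_r (\sum_j L r j *: 'X_j) * f^`M(r).

(** The exponential series of t times the vector field, cut after the second order:
    this is the true flow when the cube of the vector field kills the variables. *)
Definition flow (v : 'I_n -> K) (t : K) (r : 'I_n) : K :=
  v r + (linfield 'X_r).@[v] * t
  + (linfield (linfield 'X_r)).@[v] / 2 * t ^+ 2.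

Lemma linfieldX r : linfield 'X_r = \sum_j L r j *: 'X_j.
Proof.
rewrite /linfield (bigD1 r) //= mderivXU eqxx mulr1 [X in _ + X]big1 ?addr0 // => j jr.
by rewrite mderivXU (negbTE jr) mulr0.
Qed.

Lemma linfield_lin (c : 'I_n -> K) (h : 'I_n -> {mpoly K[n]}) :
  linfield (\sum_j c j *: h j) = \sum_j c j *: linfield (h j).
Proof.
rewrite /linfield; under eq_bigr do rewrite linear_sum mulr_sumr.
rewrite exchange_big; apply: eq_bigr => j _; rewrite scaler_sumr.
by apply: eq_bigr => r _; rewrite linearZ /= scalerAr.
Qed.

(** The velocity of the flow at time s is the vector field at the point reached, so
    the derivative of f along it is [linfield f], which is zero. *)
Lemma flow_invariant (f : {mpoly K[n]}) v t :
  (forall r, linfield (linfield (linfield 'X_r)) = 0) ->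
  linfield f = 0 -> f.@[flow v t] = f.@[v].
Proof.
move=> nil Df.
pose p r : {poly K} := (v r)%:P + (linfield 'X_r).@[v] *: 'X
  + ((linfield (linfield 'X_r)).@[v] / 2) *: 'X^2.
have pE s r : (p r).[s] = flow v s r.
  by rewrite /p !(hornerD, hornerZ, hornerC, hornerX, hornerXn).
have evL (h : 'I_n -> {mpoly K[n]}) r w :
    (\sum_j L r j *: h j).@[w] = \sum_j L r j * (h j).@[w].
  by rewrite raddf_sum; apply: eq_bigr => j _; exact: mevalZ.
have dpE s r : (p r)^`().[s] = (linfield 'X_r).@[flow v s].
  rewrite /p !derivE !(hornerD, hornerZ, hornerC, hornerX, hornerMn) add0r mulr1.
  rewrite {3}linfieldX evL; under eq_bigr do rewrite mevalXU /flow mulrDr mulrDr !mulrA.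
  rewrite !big_split /= -!mulr_suml.
  have e1 : \sum_j L r j * v j = (linfield 'X_r).@[v].
    by rewrite linfieldX evL; under [RHS]eq_bigr do rewrite mevalXU.
  have e2 : \sum_j L r j * (linfield 'X_j).@[v] = (linfield (linfield 'X_r)).@[v].
    by rewrite (linfieldX r) linfield_lin evL.
  have e3 : \sum_j L r j * (linfield (linfield 'X_j)).@[v] = 0.
    by rewrite -evL -linfield_lin -linfield_lin -linfieldX nil meval0.
  rewrite e1 e2 e3 !mul0r addr0.
  rewrite mul1r mulr1 hornerX; by field.
have [q Hq] := mpoly_along_curve f p.
have qc : forall s s', q.[s] = q.[s'].
  apply: poly_deriv0_const => s; have [_ ->] := Hq s.
  transitivity (linfield f).@[flow v s]; last by rewrite Df meval0.
  rewrite /linfield raddf_sum; apply: eq_bigr => r _ /=.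
  by rewrite mevalM -linfieldX -dpE mulrC (meval_eq _ (pE s)).
have <- : q.[t] = f.@[flow v t].
  by have [-> _] := Hq t; rewrite (meval_eq _ (pE t)).
rewrite (qc t 0); have [-> _] := Hq 0; apply: meval_eq => r.
by rewrite pE /flow mulr0 expr0n mulr0 !addr0.
Qed.

End Flow.
End Polynomials.

(** * Formal integer combinations *)

Notation comb T := (seq (int * T)).

Section Combinations.
Variables (T U : eqType).
Implicit Types (s : comb T) (t : comb U).

Fixpoint ccoef (x : T) (s : comb T) : int :=
  if s is p :: s' then if p.2 == x then p.1 + ccoef x s' else ccoef x s' else 0.

(** Equal terms are merged and zero coefficients dropped, so that a combination with
    independent labels is zero exactly when [collect] returns the empty list. *)
Definition collect s : comb T :=
  [seq p <- [seq (ccoef x s, x) | x <- undup [seq p.2 | p <- s]] | p.1 != 0].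

Definition cscale (c : int) t : comb U := [seq (c * p.1, p.2) | p <- t].

Definition cextend (f : T -> comb U) s : comb U :=
  flatten [seq cscale p.1 (f p.2) | p <- s].

Variables (K : nzRingType) (V : lmodType K) (val : T -> V).

Definition lc s : V := \sum_(p <- s) p.1%:~R *: val p.2.

Lemma lc_nil : lc [::] = 0.
Proof. exact: big_nil. Qed.

Lemma lc_cons p s : lc (p :: s) = p.1%:~R *: val p.2 + lc s.
Proof. exact: big_cons. Qed.

Lemma lc_cat s s' : lc (s ++ s') = lc s + lc s'.
Proof. exact: big_cat. Qed.

Lemma lc1 x : lc [:: (1, x)] = val x.
Proof. by rewrite lc_cons lc_nil addr0 scale1r. Qed.

Lemma lc_flatten (I : Type) (r : seq I) (F : I -> comb T) :
  lc (flatten [seq F i | i <- r]) = \sum_(i <- r) lc (F i).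
Proof. by rewrite /lc big_flatten big_map. Qed.

Lemma ccoefE x s : ccoef x s = \sum_(p <- s | p.2 == x) p.1.
Proof. by elim: s => [|p s IH]; rewrite ?big_nil // big_cons /= IH. Qed.

Lemma lc_collect s : lc (collect s) = lc s.
Proof.
rewrite /lc /collect big_filter big_map big_mkcond /=.
transitivity (\sum_(x <- undup [seq p.2 | p <- s]) (ccoef x s)%:~R *: val x).
  by apply: eq_bigr => x _; case: eqP => //= ->; rewrite scale0r.
transitivity (\sum_(x <- undup [seq p.2 | p <- s])
    \sum_(p <- s) if p.2 == x then p.1%:~R *: val p.2 else 0).
  apply: eq_bigr => x _; rewrite -big_mkcond ccoefE raddf_sum scaler_suml.
  by apply: eq_bigr => p /eqP <-.
rewrite exchange_big [LHS]big_seq [RHS]big_seq; apply: eq_bigr => p ps.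
rewrite (bigD1_seq p.2) ?undup_uniq ?mem_undup ?map_f //= eqxx big1 ?addr0 //.
by move=> x /negbTE; rewrite eq_sym => ->.
Qed.

Lemma lc_collect_eq0 s : nilp (collect s) -> lc s = 0.
Proof. by move=> /nilP s0; rewrite -lc_collect s0 lc_nil. Qed.

End Combinations.

Lemma linear_at0 (K : nzRingType) (V W : lmodType K) (g : V -> W) :
  linear g -> g 0 = 0.
Proof. by move=> /(_ (-1) 0 0); rewrite scaler0 addr0 scaleN1r addNr. Qed.

Lemma linear_sum_at (K : nzRingType) (V W : lmodType K) (g : V -> W) :
  linear g -> forall (I : Type) (r : seq I) (k : I -> K) (F : I -> V),
  g (\sum_(i <- r) k i *: F i) = \sum_(i <- r) k i *: g (F i).
Proof.
move=> gl I r k F; elim: r => [|i r IH]; first by rewrite !big_nil linear_at0.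
by rewrite !big_cons gl IH.
Qed.

Section Extension.
Variables (T U : eqType) (K : nzRingType) (V W : lmodType K).
Variables (val : T -> V) (wal : U -> W).

Lemma lc_scale c (t : comb U) : lc wal (cscale c t) = c%:~R *: lc wal t.
Proof.
rewrite /lc /cscale big_map scaler_sumr; apply: eq_bigr => p _ /=.
by rewrite intrM scalerA.
Qed.

Lemma lc_cextend (g : V -> W) (f : T -> comb U) (s : comb T) : linear g ->
  (forall x, x \in [seq p.2 | p <- s] -> g (val x) = lc wal (f x)) ->
  g (lc val s) = lc wal (cextend f s).
Proof.
move=> gl; have g0 := linear_at0 gl.
elim: s => [|p s IH] H; first by rewrite /lc !big_nil.
rewrite lc_cons gl H ?mem_head // IH => [|x xs]; last by rewrite H ?inE ?xs ?orbT.
by rewrite /cextend /= lc_cat lc_scale.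
Qed.
End Extension.

(** * The bracket of E6 in coordinates *)

Section Coordinates.

(** The prefix l marks the counterparts, on lists of coordinates with respect to the
    simple roots, of the operations on the root lattice; on lists they compute. *)
Definition lform (k l : seq int) : int :=
  2 * (k`_0 * l`_0 + k`_1 * l`_1 + k`_2 * l`_2
       + k`_3 * l`_3 + k`_4 * l`_4 + k`_5 * l`_5)
  - (k`_0 * l`_2 + k`_2 * l`_0) - (k`_2 * l`_3 + k`_3 * l`_2)
  - (k`_3 * l`_4 + k`_4 * l`_3) - (k`_4 * l`_5 + k`_5 * l`_4)
  - (k`_1 * l`_3 + k`_3 * l`_1).

Definition lexpo (k l : seq int) : int :=
  k`_0 * l`_0 + k`_1 * l`_1 + k`_2 * l`_2 + k`_3 * l`_3 + k`_4 * l`_4 + k`_5 * l`_5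
  + k`_0 * l`_2 + k`_3 * l`_1 + k`_2 * l`_3 + k`_4 * l`_3 + k`_5 * l`_4.

Definition lsign k l : int := if odd (absz (lexpo k l)) then -1 else 1.

Definition tuple6 (f : nat -> int) : seq int := [:: f 0%N; f 1%N; f 2%N; f 3%N; f 4%N; f 5%N].

Definition lnorm (k : seq int) := tuple6 (nth 0 k).
Definition lopp (k : seq int) := tuple6 (fun i => - k`_i).
Definition ladd (k l : seq int) := tuple6 (fun i => k`_i + l`_i).
Definition lunit (i : nat) := tuple6 (fun j => (j == i)%:Z).
Definition lsigma (k : seq int) := [:: k`_5; k`_1; k`_4; k`_3; k`_2; k`_0].
Definition lroot k := lform k k == 2.

Lemma nth_tuple6 f i : (i < 6)%N -> (tuple6 f)`_i = f i.
Proof. by case: i => [|[|[|[|[|[|]]]]]]. Qed.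

Lemma coor_latt s i : (i < 6)%N -> coor (latt s) i.+1 = s`_i.
Proof. by move=> i6; rewrite /coor mxE inordK. Qed.

Lemma lattE s : latt s = latt (lnorm s).
Proof. by apply/rowP => i; rewrite !mxE nth_tuple6. Qed.

Lemma latt_inj s t : (latt s == latt t) = (lnorm s == lnorm t).
Proof.
apply/eqP/eqP => [e|e]; last by rewrite lattE e -lattE.
rewrite /lnorm /tuple6; do !congr (_ :: _);
  by rewrite -coor_latt // e coor_latt.
Qed.

Lemma latt_opp s : latt (lopp s) = - latt s.
Proof. by apply/rowP => i; rewrite !mxE nth_tuple6. Qed.

Lemma latt_add s t : latt (ladd s t) = latt s + latt t.
Proof. by apply/rowP => i; rewrite !mxE nth_tuple6. Qed.

Lemma latt_sigma s : latt (lsigma s) = sigma (latt s).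
Proof.
have [e1 e2 e3 e4 [e5 e6]] := sigmaE (latt s).
apply/rowP => i; rewrite !coorE.
case: i => -[|[|[|[|[|[|]]]]]] //= _;
  by rewrite ?(e1, e2, e3, e4, e5, e6) !coor_latt.
Qed.

Lemma form_latt s t : form (latt s) (latt t) = lform s t.
Proof. by rewrite formE /= !coor_latt. Qed.

Lemma sign_odd (A : unitRingType) (n : int) :
  (-1 : A) ^ n = (if odd (absz n) then -1 else 1 : int)%:~R.
Proof.
case: n => n; rewrite ?NegzE -?exprnN -?exprnP -?exprVn ?invrN1 ?abszN -signr_odd /=;
  by case: (odd n).
Qed.

Lemma F_latt (A : unitRingType) s t : F A (latt s) (latt t) = (lsign s t)%:~R.
Proof.
rewrite /F sign_odd /lsign; congr (if odd (absz _) then _ else _)%:~R.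
by rewrite !big_ord_recr big_ord0 /= !coorE /= !coor_latt // add0r.
Qed.
End Coordinates.

Section Bracket.
Variable R : realType.
Local Notation C := R[i].

Lemma toH_coor (q : 'rV[int]_6) i : coor (toH R q) i = (coor q i)%:~R.
Proof. by rewrite /coor mxE. Qed.

Lemma form_toH p q : form (toH R p) (toH R q) = (form p q)%:~R.
Proof.
rewrite /form rmorph_sum; apply: eq_bigr => i _; rewrite rmorph_sum.
by apply: eq_bigr => j _; rewrite /= !mxE !intrM intz.
Qed.

(** A coroot is spread over the simple ones, so that elements of the Cartan
    subalgebra have a unique expression in the labels below. *)
Lemma toH_latt s : toH R (latt s) = \sum_(i <- iota 0 6) (s`_i)%:~R *: toH R (latt (lunit i)).
Proof.
apply/rowP => j; rewrite !mxE summxE.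
rewrite (bigD1_seq (j : nat)) ?iota_uniq ?mem_iota ?ltn_ord //=.
rewrite !mxE nth_tuple6 // eqxx mulr1 big1 ?addr0 // => i ij.
by rewrite !mxE nth_tuple6 // eq_sym (negbTE ij) mulr0.
Qed.

Lemma form_linl (u : 'rV[C]_6) : linear ((@form C)^~ u : _ -> C^o).
Proof.
move=> a v w; rewrite /form scaler_sumr -big_split; apply: eq_bigr => i _.
rewrite scaler_sumr -big_split; apply: eq_bigr => j _ /=.
by rewrite !mxE /GRing.scale /=; ring.
Qed.

Lemma inH_linear : linear (@inH R).
Proof.
move=> a u v; rewrite /inH; apply: injective_projections => //=.
by rewrite scaler0 addr0.
Qed.

Lemma inH_add a b :
  inH (toH R (latt a)) + inH (toH R (latt b)) = inH (toH R (latt (ladd a b))).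
Proof. by rewrite latt_add /toH map_mxD -[X in X + _]scale1r -inH_linear scale1r. Qed.

Lemma inH_opp a : - inH (toH R (latt a)) = inH (toH R (latt (lopp a))).
Proof.
rewrite latt_opp /toH map_mxN -[LHS]scaleN1r -[LHS]addr0 -[0](linear_at0 inH_linear).
by rewrite -inH_linear addr0 scaleN1r.
Qed.

Lemma bracketHE_bilinear :
  (forall v, linear (fun u => @bracketHE R u v)) /\ (forall u, linear (@bracketHE R u)).
Proof.
split=> v a u w; rewrite /bracketHE scaler_sumr -big_split; apply: eq_bigr => r _ /=.
  rewrite scalerA -scalerDl; congr (_ *: _).
  by have := form_linl (toH R (root_val r)) a u.1 w.1; rewrite /GRing.scale /= => ->; ring.
rewrite scalerA -scalerDl; congr (_ *: _).
by rewrite !ffunE /GRing.scale /=; ring.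
Qed.

Lemma bracketEE_sum_bilinear :
  (forall v, linear (fun u => @bracketEE_sum R u v)) /\ (forall u, linear (@bracketEE_sum R u)).
Proof.
split=> v a u w; rewrite /bracketEE_sum scaler_sumr -big_split;
  apply: eq_bigr => r _; rewrite scaler_sumr -big_split;
  apply: eq_bigr => s _; rewrite /= scalerA -scalerDl; congr (_ *: _);
  by rewrite !ffunE /GRing.scale /=; ring.
Qed.

Lemma bracket_linl v : linear (fun u => @bracket R u v).
Proof.
move=> a u w; rewrite /bracket.
rewrite (bracketHE_bilinear.1 v) (bracketHE_bilinear.2 v) (bracketEE_sum_bilinear.1 v).
by rewrite opprD [X in X + _ = _]addrACA [LHS]addrACA !scalerDr scalerN.
Qed.

Lemma bracket_linr u : linear (@bracket R u).
Proof.
move=> a v w; rewrite /bracket.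
rewrite (bracketHE_bilinear.1 u) (bracketHE_bilinear.2 u) (bracketEE_sum_bilinear.2 u).
by rewrite opprD [X in X + _ = _]addrACA [LHS]addrACA !scalerDr scalerN.
Qed.

Lemma bracketHE_E (u : E6 R) q : bracketHE u (E R q) = form u.1 (toH R q) *: E R q.
Proof.
rewrite /bracketHE; have [a aq | nq] := pickP (fun a : root => root_val a == q).
  rewrite (bigD1 a) //= ffunE aq mulr1 -(eqP aq) big1 ?addr0 // => b /negbTE ba.
  by rewrite ffunE -[root_val b == _]/(b == a) ba mulr0 scale0r.
rewrite big1 => [|a _]; last by rewrite ffunE nq mulr0 scale0r.
rewrite (_ : E R q = 0) ?scaler0 //.
by congr (_, _); apply/ffunP => a; rewrite !ffunE nq.
Qed.

Lemma bracketHE_inH (u : E6 R) h : bracketHE u (inH h) = 0.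
Proof. by rewrite /bracketHE big1 // => a _; rewrite ffunE mulr0 scale0r. Qed.

Lemma form0l (u : 'rV[C]_6) : form 0 u = 0.
Proof. by rewrite /form big1 // => i _; rewrite big1 // => j _; rewrite mxE mulr0 mul0r. Qed.

Lemma bracketHE_El q (v : E6 R) : bracketHE (E R q) v = 0.
Proof. by rewrite /bracketHE big1 // => a _; rewrite form0l mul0r scale0r. Qed.

Lemma bracketEE_sum_inHl h (v : E6 R) : bracketEE_sum (inH h) v = 0.
Proof.
by rewrite /bracketEE_sum big1 // => a _; rewrite big1 // => b _; rewrite ffunE mul0r scale0r.
Qed.

Lemma bracketEE_sum_inHr h (u : E6 R) : bracketEE_sum u (inH h) = 0.
Proof.
by rewrite /bracketEE_sum big1 // => a _; rewrite big1 // => b _; rewrite ffunE mulr0 scale0r.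
Qed.

Lemma E_nonroot q : form q q != 2 -> E R q = 0.
Proof.
move=> nq; congr (_, _); apply/ffunP => a; rewrite !ffunE.
by case: eqP => // aq; rewrite -aq (eqP (valP a)) eqxx in nq.
Qed.

Lemma E_coef q a : (E R q).2 a = (root_val a == q)%:R :> C.
Proof. by rewrite ffunE. Qed.

Lemma bracketEE_sumE (a b : root) :
  bracketEE_sum (E R (root_val a)) (E R (root_val b)) = bracketEE R a b.
Proof.
rewrite /bracketEE_sum (bigD1 a) //= [X in _ + X]big1 ?addr0 => [|c /negbTE ca].
  rewrite (bigD1 b) //= [X in _ + X]big1 ?addr0 => [|c /negbTE cb].
    by rewrite !E_coef !eqxx mulr1 scale1r.
  by rewrite !E_coef -[root_val c == _]/(c == b) cb mulr0 scale0r.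
by rewrite big1 // => d _; rewrite E_coef -[root_val c == _]/(c == a) ca mul0r scale0r.
Qed.

(** A label is the index of a simple coroot (counted from 0) or the coordinates of a
    root; the labels that are [proper] below name a basis of E6. *)
Definition label : Type := (nat + seq int)%type.

Definition label_vec (b : label) : E6 R :=
  match b with
  | inl i => inH (toH R (latt (lunit i)))
  | inr q => E R (latt q)
  end.

Definition label_bracket (x y : label) : comb label :=
  match x, y with
  | inl _, inl _ => [::]
  | inl i, inr q => [:: (lform (lunit i) q, inr q)]
  | inr q, inl i => [:: (- lform (lunit i) q, inr q)]
  | inr q, inr p =>
    if lroot q && lroot p then
      if lnorm p == lopp q then [seq (- q`_i, inl i) | i <- iota 0 6]
      else if lroot (ladd q p) then [:: (lsign q p, inr (ladd q p))] else [::]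
    else [::]
  end.

(** On a label that is not a root, E is 0 and hence so is the bracket. *)
Lemma bracket_label_vec x y :
  bracket (label_vec x) (label_vec y) = lc label_vec (label_bracket x y).
Proof.
case: x y => [i|q] [j|p]; rewrite /label_vec /label_bracket /bracket.
- by rewrite !bracketHE_inH bracketEE_sum_inHl lc_nil subrr addr0.
- rewrite bracketHE_E bracketHE_inH bracketEE_sum_inHl subr0 addr0.
  by rewrite /lc big_seq1 form_toH form_latt.
- rewrite bracketHE_E bracketHE_inH bracketEE_sum_inHr addr0 sub0r.
  by rewrite /lc big_seq1 form_toH form_latt rmorphN scaleNr.
rewrite !bracketHE_El subr0 add0r.
case: ifPn => [/andP[rq rp]|]; last first.
  rewrite /lroot negb_and -!form_latt lc_nil => /orP[] /E_nonroot ->.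
    exact: linear_at0 (bracketEE_sum_bilinear.1 _).
  exact: linear_at0 (bracketEE_sum_bilinear.2 _).
have rq' : form (latt q) (latt q) == 2 by rewrite form_latt.
have rp' : form (latt p) (latt p) == 2 by rewrite form_latt.
rewrite -[latt q]/(root_val (Root rq')) -[latt p]/(root_val (Root rp')).
rewrite bracketEE_sumE /bracketEE; cbv zeta.
rewrite -[root_val (Root rq')]/(latt q) -[root_val (Root rp')]/(latt p).
rewrite -latt_opp latt_inj -latt_add form_latt F_latt.
have -> : lnorm (lopp q) = lopp q by [].
case: ifP => _.
  rewrite /lc big_map toH_latt.
  transitivity (\sum_(i <- iota 0 6) ((lopp q)`_i)%:~R *: inH (toH R (latt (lunit i)))).
    elim: (iota 0 6) => [|i s IH]; first by rewrite !big_nil.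
    by rewrite !big_cons -IH inH_linear.
  rewrite !big_seq; apply: eq_bigr => i; rewrite mem_iota => /andP[_ i6].
  by rewrite nth_tuple6.
by rewrite /lroot; case: ifP => _; rewrite ?lc_cons lc_nil ?addr0.
Qed.

Definition comb_bracket (u v : comb label) : comb label :=
  collect (cextend (fun x => cextend (label_bracket x) v) u).

Lemma bracket_lc u v :
  bracket (lc label_vec u) (lc label_vec v) = lc label_vec (comb_bracket u v).
Proof.
rewrite lc_collect; apply: lc_cextend (bracket_linl _) _ => x _.
by apply: lc_cextend (bracket_linr _) _ => y _; apply: bracket_label_vec.
Qed.

End Bracket.

(** * The action on polynomials, computed on monomials *)

(** A monomial is kept as the weakly increasing list of the numbers of its
    variables. *)
Notation cpoly := (comb (seq nat)).

Definition beta_coords (r : nat) : seq int :=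
  nth [::] [::
    [:: 1; 1; 2; 2; 1; 1]; [:: 1; 1; 2; 2; 1; 0]; [:: 1; 1; 1; 2; 1; 0];
    [:: 1; 1; 1; 1; 1; 0]; [:: 1; 1; 1; 1; 0; 0]; [:: 1; 0; 1; 1; 1; 0];
    [:: 0; 1; 1; 1; 0; 0]; [:: 1; 0; 1; 1; 0; 0]; [:: 0; 0; 1; 1; 0; 0];
    [:: 1; 0; 1; 0; 0; 0]; [:: 0; 0; 1; 0; 0; 0]; [:: 1; 0; 0; 0; 0; 0]] r.-1.

Definition xvec_comb (r : nat) : comb label :=
  if (r <= 12)%N then [:: (1, inr (beta_coords r)); (-1, inr (lsigma (beta_coords r)))]
  else if r == 13%N then [:: (1, inl 0%N); (-1, inl 5%N)]
  else if r == 14%N then [:: (1, inl 2%N); (-1, inl 4%N)]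
  else [:: (1, inr (lopp (beta_coords (27 - r))));
           (-1, inr (lopp (lsigma (beta_coords (27 - r)))))].

(** Among x_1, ..., x_26, the label [probe r] only occurs in x_r, with coefficient 1:
    the coefficient there is the r-th coordinate of a vector of V. *)
Definition probe (r : nat) : label := (head (0, inl 0%N) (xvec_comb r)).2.

Definition proper (b : label) : bool :=
  match b with inl i => (i < 6)%N | inr q => lroot q && (lnorm q == q) end.

(** The coordinates of [u, x_r] are read off at the probes, which presupposes that
    [u, x_r] lies in V; [var_image_ok] verifies this by subtracting from it the
    combination of the x_j found. *)
Definition var_image (u : comb label) (r : nat) : cpoly :=
  let w := comb_bracket u (xvec_comb r) in
  [seq p <- [seq (ccoef (probe j) w, [:: j]) | j <- iota 1 26] | p.1 != 0].

Definition var_image_ok (u : comb label) (r : nat) : bool :=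
  nilp (collect (comb_bracket u (xvec_comb r) ++
    cextend (fun m : seq nat => cscale (-1) (xvec_comb (head 0%N m))) (var_image u r))).

Definition var_images (u : comb label) : seq cpoly := [seq var_image u r | r <- iota 1 26].

Definition pmul (p q : cpoly) : cpoly :=
  cextend (fun m => [seq (t.1, sort leq (m ++ t.2)) | t <- q]) p.

Fixpoint leibniz (D : seq cpoly) (m : seq nat) : cpoly :=
  if m is i :: m' then
    pmul (nth [::] D i.-1) [:: (1, m')] ++ pmul [:: (1, [:: i])] (leibniz D m')
  else [::].

Definition derive_poly (D : seq cpoly) (p : cpoly) : cpoly := collect (cextend (leibniz D) p).

Definition var_range (p : cpoly) : bool :=
  all (fun t => all (fun i => (0 < i <= 26)%N) t.2) p.

Section Module.
Variable R : realType.
Local Notation C := R[i].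
Local Notation A := {mpoly C[26]}.
Local Notation label_vec := (@label_vec R).

Lemma xvec_lc r : xvec R r = lc label_vec (xvec_comb r).
Proof.
rewrite /xvec /xvec_comb; case: ifP => _; [|case: ifP => _; [|case: ifP => _]];
  rewrite !lc_cons lc_nil addr0 /= scale1r scaleN1r.
- by rewrite latt_sigma.
- by rewrite inH_opp inH_add.
- by rewrite inH_opp inH_add.
by rewrite !latt_opp latt_sigma.
Qed.

(** The sum extracts the coefficient at the root with coordinates q. *)
Definition component (b : label) (w : E6 R) : C^o :=
  match b with
  | inl i => coor w.1 i.+1
  | inr q => \sum_(a : root) (root_val a == latt q)%:R * (w.2 a : C)
  end.

Lemma component_linear b : linear (component b).
Proof.
case: b => [i|q] c u w; first by rewrite /component /coor !mxE.
rewrite /component scaler_sumr -big_split; apply: eq_bigr => a _ /=.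
by rewrite !ffunE /GRing.scale /=; ring.
Qed.

Lemma component_label_vec b b' : proper b -> proper b' ->
  component b (label_vec b') = (b' == b)%:R.
Proof.
case: b b' => [i|q] [j|q'] /=.
- move=> i6 j6; rewrite toH_coor coor_latt // nth_tuple6 //.
  by rewrite -[inl j == inl i]/(j == i) eq_sym; case: eqP.
- by move=> i6 _; rewrite /coor mxE.
- by move=> _ _; rewrite big1 // => a _; rewrite ffunE mulr0.
move=> /andP[rq /eqP nq] /andP[_ /eqP nq'].
have rq1 : form (latt q) (latt q) == 2 by rewrite form_latt.
rewrite (bigD1 (Root rq1)) //= eqxx mul1r big1 ?addr0 => [|a /negbTE aq].
  by rewrite ffunE latt_inj nq nq' eq_sym.
by rewrite -[_ == latt q]/(a == Root rq1) aq mul0r.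
Qed.

Lemma component_lc b s : proper b -> all (fun p => proper p.2) s ->
  component b (lc label_vec s) = (ccoef b s)%:~R.
Proof.
move=> pb; elim: s => [|p s IH] /=; first by rewrite lc_nil (linear_at0 (component_linear b)).
move=> /andP[pp ps]; rewrite lc_cons component_linear IH // component_label_vec //.
by case: eqP => _; rewrite ?intrD /GRing.scale /= ?mulr1 ?mulr0 ?add0r.
Qed.

Lemma probe_check :
  all (fun i => proper (probe i) && all (fun p => proper p.2) (xvec_comb i) &&
    all (fun j => ccoef (probe j) (xvec_comb i) == (i == j)) (iota 1 26)) (iota 1 26).
Proof. by vm_compute. Qed.

Lemma component_xvec (i j : 'I_26) : component (probe j.+1) (xvec R i.+1) = (i == j)%:R.
Proof.
have /allP chk := probe_check.
have io (k : 'I_26) : k.+1 \in iota 1 26 by rewrite mem_iota; case: k.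
have /andP[/andP[_ pi] /allP /(_ _ (io j)) /eqP e] := chk _ (io i).
have /andP[/andP[pj _] _] := chk _ (io j).
by rewrite xvec_lc component_lc // e eqSS -val_eqE /=; case: (_ == _).
Qed.

Lemma xbasisE (i : 'I_26) : (xbasis R)`_i = xvec R i.+1.
Proof. by rewrite -tnth_nth tnth_mktuple. Qed.

(** The components at the probes form a dual family. *)
Lemma xbasis_free : free (xbasis R).
Proof.
apply/freeP => k k0 j; have := congr1 (component (probe j.+1)) k0.
rewrite (linear_sum_at (component_linear _)) (linear_at0 (component_linear _)).
rewrite (bigD1 j) //= big1 ?addr0 => [|i /negbTE ij]; rewrite xbasisE component_xvec.
  by rewrite eqxx /GRing.scale /= mulr1.
by rewrite ij scaler0.
Qed.

Lemma linpol_linear : linear (@linpol R).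
Proof.
move=> c u w; rewrite /linpol scaler_sumr -big_split; apply: eq_bigr => r _ /=.
by rewrite linearD linearZ /= scalerA -scalerDl.
Qed.

Lemma inord_pred r : (0 < r <= 26)%N -> (inord r.-1 : 'I_26) = r.-1 :> nat.
Proof. by case: r => //= r; apply: inordK. Qed.

Lemma linpol_xvec r : (0 < r <= 26)%N -> linpol (xvec R r) = X R r.
Proof.
move=> rb; have re := inord_pred rb.
have -> : xvec R r = (xbasis R)`_(inord r.-1 : 'I_26).
  by rewrite xbasisE re prednK //; case/andP: rb.
rewrite /linpol (bigD1 (inord r.-1)) //= big1 ?addr0 => [|i /negbTE ij].
  by rewrite coord_free ?xbasis_free // eqxx scale1r.
by rewrite coord_free ?xbasis_free // eq_sym ij scale0r.
Qed.

Lemma actE u f :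
  act u f = linfield (fun r j => coord (xbasis R) j (bracket u (xbasis R)`_r)) f.
Proof. by []. Qed.

Lemma act_linear u : linear (@act R u).
Proof.
move=> c f g; rewrite /act scaler_sumr -big_split; apply: eq_bigr => r _ /=.
by rewrite mderivD mderivZ mulrDr scalerAr.
Qed.

Lemma act_linear_l f : linear (fun u => @act R u f).
Proof.
move=> c u w; rewrite /act scaler_sumr -big_split; apply: eq_bigr => r _ /=.
by rewrite bracket_linl linpol_linear mulrDl scalerAl.
Qed.

Lemma actM u f g : @act R u (f * g) = act u f * g + f * act u g.
Proof.
rewrite /act mulr_suml mulr_sumr -big_split; apply: eq_bigr => r _ /=.
by rewrite mderivM; ring.
Qed.

Lemma act_const u c : @act R u c%:MP = 0.
Proof. by rewrite /act big1 // => r _; rewrite mderivC mulr0. Qed.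

Lemma act1 u : @act R u 1 = 0.
Proof. exact: (act_const u 1). Qed.

Lemma act_X u r : (0 < r <= 26)%N -> act u (X R r) = linpol (bracket u (xvec R r)).
Proof.
move=> rb; rewrite /X actE linfieldX xbasisE (inord_pred rb) prednK //.
by case/andP: rb.
Qed.

Definition mon (m : seq nat) : A := \prod_(i <- m) X R i.

Lemma mon_nil : mon [::] = 1.
Proof. exact: big_nil. Qed.

Lemma mon_cons i m : mon (i :: m) = X R i * mon m.
Proof. exact: big_cons. Qed.

Lemma bracket_xvec u r : var_image_ok u r ->
  bracket (lc label_vec u) (xvec R r) =
  \sum_(p <- var_image u r) p.1%:~R *: xvec R (head 0%N p.2).
Proof.
move=> /(lc_collect_eq0 label_vec); rewrite lc_cat -bracket_lc -xvec_lc => H.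
apply/eqP; rewrite -subr_eq0 -[X in _ == X]H; apply/eqP; congr (_ + _).
rewrite /cextend lc_flatten -sumrN; apply: eq_bigr => p _.
by rewrite !lc_scale -xvec_lc scaleN1r scalerN.
Qed.

Lemma act_X_image u r : (0 < r <= 26)%N -> var_image_ok u r ->
  act (lc label_vec u) (X R r) = lc mon (var_image u r).
Proof.
move=> rb /bracket_xvec br; rewrite act_X // br.
rewrite (linear_sum_at linpol_linear) /lc !big_seq; apply: eq_bigr => p.
rewrite mem_filter => /andP[_ /mapP[j jb ->]] /=.
by rewrite linpol_xvec ?mon_cons /mon ?big_nil ?mulr1 // -[(_ <= 26)%N]ltnS -mem_iota.
Qed.

Lemma lc_pmul p q : lc mon (pmul p q) = lc mon p * lc mon q.
Proof.
symmetry; apply: (lc_cextend (g := fun f => f * lc mon q)).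
  by move=> c f g; rewrite mulrDl scalerAl.
move=> m _; rewrite /lc big_map mulr_sumr; apply: eq_bigr => t _ /=.
rewrite -scalerAr; congr (_ *: _); rewrite /mon -big_cat.
by apply: perm_big; rewrite perm_sym perm_sort.
Qed.

Lemma lc_mon1 m : lc mon [:: (1, m)] = mon m.
Proof. by rewrite lc_cons lc_nil addr0 scale1r. Qed.

Lemma act_lc_mon u p : var_range p -> all (var_image_ok u) (iota 1 26) ->
  act (lc label_vec u) (lc mon p) = lc mon (derive_poly (var_images u) p).
Proof.
move=> /allP pr /allP ru; rewrite lc_collect; apply: lc_cextend (act_linear _) _.
move=> _ /mapP[t /pr tr ->]; move: tr.
elim: t.2 => [_|i m IH /andP[ib mb]]; first by rewrite mon_nil act1 lc_nil.
rewrite mon_cons actM [RHS]lc_cat !lc_pmul !lc_mon1 -IH // (mon_cons i [::]).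
rewrite mon_nil mulr1.
have ii : i \in iota 1 26 by rewrite mem_iota.
rewrite act_X_image ?ru // (nth_map 0%N) ?size_iota; last by case: (i) ib.
by rewrite nth_iota ?add1n ?prednK //; case: (i) ib.
Qed.

End Module.

(** * The generators as integer polynomials *)

Definition rootvec_comb (q : seq int) : comb label :=
  if lsigma q == q then [:: (1, inr q)] else [:: (1, inr q); (1, inr (lsigma q))].

Fixpoint box (n : nat) : seq (seq int) :=
  if n is n'.+1 then [seq x :: s | x <- [:: 0; 1; 2; 3], s <- box n'] else [:: [::]].

(** Coordinates of roots are at most 3 in absolute value ([root_bound]). *)
Definition posroots : seq (seq int) := [seq q <- box 6 | lroot q].

Definition pterm (c : nat) (m : seq nat) : int * seq nat := (c%:Z, m).
Definition nterm (c : nat) (m : seq nat) : int * seq nat := (- c%:Z, m).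
(** The step (j, s, q, c) with c = 1 or -1 stands for [u, x_s] = c x_j, where u is the
    negative root vector attached to the positive root q. *)
Definition descent_step (j s : nat) (q : seq nat) (c : int) := (j, s, map Posz q, c).

Section Data.
Local Open Scope nat_scope.

Definition x1_poly : cpoly := [:: pterm 1 [:: 1]].
Definition zeta1_poly : cpoly :=
  [:: pterm 2 [:: 1; 13]; pterm 1 [:: 1; 14]; nterm 3 [:: 2; 12]; nterm 3 [:: 3; 10];
      pterm 3 [:: 4; 8]; nterm 3 [:: 5; 6]].
Definition vartheta_poly : cpoly :=
  [:: nterm 1 [:: 1; 2; 13]; pterm 1 [:: 1; 1; 15]; nterm 1 [:: 1; 3; 11];
      pterm 1 [:: 1; 4; 9]; nterm 1 [:: 1; 6; 7]; pterm 1 [:: 2; 2; 12];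
      pterm 1 [:: 2; 3; 10]; nterm 1 [:: 2; 4; 8]; pterm 1 [:: 2; 5; 6]].
Definition eta1_poly : cpoly :=
  [seq pterm 3 [:: r; 27 - r] | r <- iota 1 12] ++
  [:: nterm 1 [:: 13; 13]; nterm 1 [:: 13; 14]; nterm 1 [:: 14; 14]].

(** Every x_j is reached from x_1 by negative root vectors. *)
Definition descent : seq (nat * nat * seq int * int) :=
  [:: descent_step 2 1 [:: 0; 0; 0; 0; 0; 1] 1%R; descent_step 3 1 [:: 0; 0; 0; 0; 1; 1] 1%R;
      descent_step 4 1 [:: 0; 0; 0; 1; 1; 1] (-1)%R; descent_step 5 1 [:: 0; 0; 1; 1; 1; 1] 1%R;
      descent_step 6 1 [:: 0; 1; 0; 1; 1; 1] 1%R; descent_step 8 1 [:: 0; 1; 1; 1; 1; 1] (-1)%R;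
      descent_step 7 1 [:: 1; 0; 1; 1; 1; 1] (-1)%R; descent_step 10 1 [:: 0; 1; 1; 2; 1; 1] 1%R;
      descent_step 9 1 [:: 1; 1; 1; 1; 1; 1] 1%R; descent_step 12 1 [:: 0; 1; 1; 2; 2; 1] 1%R;
      descent_step 11 1 [:: 1; 1; 1; 2; 1; 1] (-1)%R; descent_step 14 1 [:: 1; 1; 1; 2; 2; 1] 1%R;
      descent_step 16 1 [:: 1; 1; 2; 2; 2; 1] (-1)%R; descent_step 18 1 [:: 1; 1; 2; 3; 2; 1] 1%R;
      descent_step 20 1 [:: 1; 2; 2; 3; 2; 1] (-1)%R; descent_step 15 2 [:: 1; 1; 1; 2; 2; 1] (-1)%R;
      descent_step 17 2 [:: 1; 1; 2; 2; 2; 1] 1%R; descent_step 19 2 [:: 1; 1; 2; 3; 2; 1] (-1)%R;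
      descent_step 22 2 [:: 1; 2; 2; 3; 2; 1] 1%R; descent_step 13 3 [:: 0; 1; 1; 2; 1; 1] 1%R;
      descent_step 21 3 [:: 1; 1; 2; 3; 2; 1] 1%R; descent_step 23 3 [:: 1; 2; 2; 3; 2; 1] (-1)%R;
      descent_step 24 4 [:: 1; 2; 2; 3; 2; 1] 1%R; descent_step 25 5 [:: 1; 2; 2; 3; 2; 1] (-1)%R;
      descent_step 26 7 [:: 1; 2; 2; 3; 2; 1] 1%R].

Definition table_get (j : nat) (tab : seq (nat * cpoly)) : cpoly :=
  (head (0%N, [::]) [seq p <- tab | p.1 == j]).2.

Definition descend (tab : seq (nat * cpoly)) (e : nat * nat * seq int * int) :=
  let: (j, s, q, c) := e in
  (j, cscale c (derive_poly (var_images (rootvec_comb (lopp q))) (table_get s tab))) :: tab.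

Definition zeta_table : seq (nat * cpoly) := foldl descend [:: (1%N, zeta1_poly)] descent.
Definition zeta_poly (r : nat) : cpoly := table_get r zeta_table.

Definition eta2_comb (z : nat -> cpoly) : cpoly := collect (
  cscale 3%R (flatten [seq pmul (z r) [:: pterm 1 [:: 27 - r]] ++
                         pmul [:: pterm 1 [:: r]] (z (27 - r)%N) | r <- iota 1 12])
  ++ cscale (-2)%R (pmul [:: pterm 1 [:: 13]] (z 13))
  ++ cscale (-1)%R (pmul [:: pterm 1 [:: 13]] (z 14))
  ++ cscale (-1)%R (pmul [:: pterm 1 [:: 14]] (z 13))
  ++ cscale (-2)%R (pmul [:: pterm 1 [:: 14]] (z 14))).

Definition eta2_poly : cpoly := eta2_comb zeta_poly.
End Data.

Definition generator_polys : seq cpoly :=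
  [:: x1_poly; zeta1_poly; vartheta_poly; eta1_poly; eta2_poly].

Lemma table_get_mem r tab : r \in [seq p.1 | p <- tab] -> (r, table_get r tab) \in tab.
Proof.
case/mapP => p0 p0in ->; rewrite /table_get.
have : p0 \in [seq p <- tab | p.1 == p0.1] by rewrite mem_filter eqxx.
case E: [seq p <- tab | p.1 == p0.1] => [//|p1 l] _ /=.
have : p1 \in [seq p <- tab | p.1 == p0.1] by rewrite E mem_head.
by rewrite mem_filter => /andP[/eqP <-]; case: p1 {E}.
Qed.

(** The conditions on q are verified along with the invariance: its coordinates are
    in normal form, and the images of the variables under its root vector are
    correct. *)
Lemma killed_check :
  all var_range generator_polys &&
  all (fun q => let D := var_images (rootvec_comb q) in
    [&& lnorm q == q, all (var_image_ok (rootvec_comb q)) (iota 1 26) &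
        all (fun g => nilp (derive_poly D g)) generator_polys]) posroots.
Proof. by vm_compute. Qed.

Definition descent_step_ok (tab : seq (nat * cpoly)) (e : nat * nat * seq int * int) :=
  let: (j, s, q, c) := e in let u := rootvec_comb (lopp q) in
  [&& s \in [seq p.1 | p <- tab], (0 < s <= 26)%N, c * c == 1, lnorm q == q,
      all (var_image_ok u) (iota 1 26), var_image u s == [:: (c, [:: j])] & var_range (table_get s tab)].

Fixpoint descent_ok (tab : seq (nat * cpoly)) l :=
  if l is e :: l' then descent_step_ok tab e && descent_ok (descend tab e) l' else true.

Lemma descent_check : descent_ok [:: (1%N, zeta1_poly)] descent &&
  all (fun r => r \in [seq p.1 | p <- zeta_table]) (iota 1 26).
Proof. by vm_compute. Qed.

Section Link.
Variable R : realType.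
Local Notation C := R[i].
Local Notation label_vec := (@label_vec R).
Local Notation mon := (@mon R).

Lemma pos_rootvecE q : lnorm q = q ->
  pos_rootvec R (latt q) = lc label_vec (rootvec_comb q).
Proof.
move=> nq; rewrite /pos_rootvec /rootvec_comb -latt_sigma latt_inj nq.
have -> : lnorm (lsigma q) = lsigma q by [].
case: ifP => _; first by rewrite lc1.
by rewrite -cat1s lc_cat !lc1.
Qed.

Lemma box_mem s : all (fun x : int => 0 <= x <= 3) s -> s \in box (size s).
Proof.
elim: s => // x s IH /andP[x03 /IH sb]; apply: allpairs_f sb.
by rewrite !inE; lia.
Qed.

Lemma positive_posroots (a : root) : positive (root_val a) ->
  exists2 q, q \in posroots & root_val a = latt q.
Proof.
move=> /forallP ap; pose q := tuple6 (fun i => coor (root_val a) i.+1).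
have aq : root_val a = latt q.
  by apply/rowP => i; rewrite mxE nth_tuple6 // -coorE.
exists q => //; rewrite mem_filter /lroot -form_latt -aq (valP a) /=.
apply: (box_mem (s := q)); apply/allP => x; rewrite -[q]/(map _ (iota 0 6)).
case/mapP => i; rewrite mem_iota => /andP[_ i6] ->.
have := ap (Ordinal i6); have := root_bound a (Ordinal i6); rewrite coorE /=.
by move=> /andP[_ ->] ->.
Qed.

Lemma scale_intr (c : int) (f : {mpoly C[26]}) : c%:~R *: f = c%:~R * f.
Proof. by rewrite scaler_int mulrzl. Qed.

Lemma lc_mon_cons p s : lc mon (p :: s) = p.1%:~R * mon p.2 + lc mon s.
Proof. by rewrite lc_cons scaler_int mulrzl. Qed.

Lemma x1E : X R 1 = lc mon x1_poly.
Proof. by rewrite lc_mon1 mon_cons mon_nil mulr1. Qed.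

Lemma zeta1E : zeta1 R = lc mon zeta1_poly.
Proof.
rewrite /zeta1 /zeta1_poly !lc_mon_cons lc_nil /= /mon !big_cons !big_nil.
by move: (X R) => x; rewrite /pterm /nterm; ring.
Qed.

Lemma varthetaE : vartheta R = lc mon vartheta_poly.
Proof.
rewrite /vartheta /vartheta_poly !lc_mon_cons lc_nil /= /mon !big_cons !big_nil.
by move: (X R) => x; rewrite /pterm /nterm; ring.
Qed.

Lemma eta1E : eta1 R = lc mon eta1_poly.
Proof.
rewrite /eta1 /eta1_poly lc_cat -!addrA; congr (_ + _).
  rewrite /lc big_map mulr_sumr; apply: eq_bigr => r _.
  by rewrite [X in X *: _]/= scaler_int -mulrzl !mon_cons /mon big_nil mulr1.
rewrite !lc_mon_cons lc_nil /mon !big_cons !big_nil.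
by move: (X R) => x; rewrite /nterm /=; ring.
Qed.

Lemma generator_polys_killed g : g \in generator_polys -> killed_by_positive (lc mon g).
Proof.
move=> gin a /positive_posroots[q qp ->].
have /andP[/allP vr /allP /(_ q qp) /and3P[/eqP nq ru /allP kg]] := killed_check.
rewrite pos_rootvecE // act_lc_mon ?vr //.
by rewrite (nilP (kg _ gin)) lc_nil.
Qed.

Lemma pos_rootvec_GF4 q : pos_rootvec R q \in GF4 R.
Proof.
rewrite GF4P /pos_rootvec; case: ifP => [/eqP e|_]; first by rewrite sigma_hatE e.
by rewrite sigma_hatD !sigma_hatE sigmaK addrC.
Qed.

Lemma xvec_V26 r : xvec R r \in V26 R.
Proof.
rewrite V26P /xvec; case: ifP => _; [|case: ifP => _; [|case: ifP => _]].
- by rewrite sigma_hatB !sigma_hatE sigmaK opprB.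
- by rewrite sigma_hatH -toH_sigma -latt_sigma inH_opp.
- by rewrite sigma_hatH -toH_sigma -latt_sigma inH_opp.
by rewrite sigma_hatB !sigma_hatE !sigmaN sigmaK opprB.
Qed.

Section Zeta.
Variable phi : {linear subvs_of (V26 R) -> {mpoly C[26]}}.
Hypothesis hphi : isom_onto_generated (zeta1 R) phi.

Lemma act_zeta u s : u \in GF4 R ->
  phi (vsproj (V26 R) (bracket u (xvec R s))) = act u (zeta phi s).
Proof.
have [_ H _ _] := hphi; move=> uG.
have e : vsval (vsproj (V26 R) (xvec R s)) = xvec R s := vsprojK (xvec_V26 s).
have E := H u (vsproj (V26 R) (xvec R s)) uG.
by rewrite e in E.
Qed.

(** The module morphism phi turns [u, x_s] = c x_j into u(zeta_s) = c zeta_j, and c is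
    its own inverse. *)
Lemma zeta_descend tab e : descent_step_ok tab e ->
  (forall p, p \in tab -> zeta phi p.1 = lc mon p.2) ->
  forall p, p \in descend tab e -> zeta phi p.1 = lc mon p.2.
Proof.
case: e => [[[j s] q] c] /and5P[sin sb /eqP cc /eqP nq /and3P[ru /eqP rs vr]] H p.
rewrite inE => /predU1P[->|/H //] /=.
have zs : zeta phi s = lc mon (table_get s tab) := H _ (table_get_mem sin).
have nlq : lnorm (lopp q) = lopp q by [].
have uG : lc label_vec (rootvec_comb (lopp q)) \in GF4 R by rewrite -pos_rootvecE // pos_rootvec_GF4.
have := act_zeta s uG; rewrite zs act_lc_mon //.
rewrite bracket_xvec ?rs; last by move/allP: ru => /(_ s); apply; rewrite mem_iota.
rewrite big_seq1 /= !linearZ /= lc_scale => <-.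
by rewrite scalerA -intrM cc scale1r.
Qed.

Lemma zeta_lc r : (0 < r <= 26)%N -> zeta phi r = lc mon (zeta_poly r).
Proof.
move=> rb; have /andP[chk /allP /(_ r)] := descent_check.
rewrite mem_iota => /(_ rb) rin.
have H : forall p, p \in zeta_table -> zeta phi p.1 = lc mon p.2.
  have H0 p : p \in [:: (1%N, zeta1_poly)] -> zeta phi p.1 = lc mon p.2.
    by rewrite inE => /eqP ->; have [_ _ _] := hphi; rewrite zeta1E.
  rewrite /zeta_table; elim: descent [:: _] H0 chk => //= e l IH tab H0 /andP[ok1 ok2].
  by apply: IH ok2; apply: zeta_descend.
exact: H _ (table_get_mem rin).
Qed.

Lemma lc_mon_var i : lc mon [:: pterm 1 [:: i]] = X R i.
Proof. by rewrite lc_mon1 mon_cons mon_nil mulr1. Qed.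

(** An arbitrary family stands for the zeta_r: only the shape of eta_2 matters here. *)
Lemma lc_eta2_comb z (Z : nat -> {mpoly C[26]}) :
  (forall r, (0 < r <= 26)%N -> lc mon (z r) = Z r) ->
  lc mon (eta2_comb z) =
  3 * (\sum_(1 <= r < 13) (Z r * X R (27 - r) + X R r * Z (27 - r)%N))
  - 2 * X R 13 * Z 13%N - X R 13 * Z 14%N - X R 14 * Z 13%N - 2 * X R 14 * Z 14%N.
Proof.
move=> zZ; rewrite /eta2_comb lc_collect !lc_cat !lc_scale !lc_pmul !lc_mon_var !zZ //.
rewrite lc_flatten; set S := (X in _ *: X + _ = _).
set T := (X in _ = 3 * X - _ - _ - _ - _); have -> : S = T.
  rewrite /S /T /index_iota !big_seq; apply: eq_bigr => r; rewrite mem_iota => rb.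
  by rewrite lc_cat !lc_pmul !lc_mon_var !zZ //; move: rb; lia.
move: T (X R) => T x; rewrite !scale_intr.
by ring.
Qed.

Lemma eta2E : eta2 phi = lc mon eta2_poly.
Proof. by rewrite (lc_eta2_comb (Z := zeta phi)) // => r /zeta_lc. Qed.

Lemma generatorsE (i : 'I_5) : tnth (generators phi) i = lc mon (nth [::] generator_polys i).
Proof.
by rewrite (tnth_nth 0); case: i => -[|[|[|[|[|]]]]] //= _;
  rewrite ?x1E ?zeta1E ?varthetaE ?eta1E ?eta2E.
Qed.

Lemma nth_generator_polys (i : 'I_5) : nth [::] generator_polys i \in generator_polys.
Proof. by apply: mem_nth; case: i. Qed.

Lemma generators_killed i : killed_by_positive (tnth (generators phi) i).
Proof. by rewrite generatorsE; apply/generator_polys_killed/nth_generator_polys. Qed.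

End Zeta.
End Link.

(** * Moving a point to the slice *)

(** Polynomials in the ideal generated by the variables numbered in Z. *)
Definition meets (Z : seq nat) (p : cpoly) := all (fun t => has (mem Z) t.2) p.

(** A move: the coordinate to be cleared and the positive root whose flow does it. *)
Definition clears (r : nat) (q : seq nat) : nat * seq int := (r, map Posz q).

(** This makes [flow] the exponential of the root vector. *)
Definition cube_zero (D : seq cpoly) (s : nat) : bool :=
  let d := derive_poly D (nth [::] D s.-1) in var_range d && nilp (derive_poly D d).

(** The coordinates in Z are already zero and x_p is the pivot.  Modulo the ideal of
    Z, the root vector must send x_r to a nonzero multiple of x_p and send x_p and the
    variables of Z to 0, and its square must kill all of these: then its flow changes
    x_r by a multiple of t x_p and fixes x_p and the zeros. *)
Definition move_ok (p : nat) (Z : seq nat) (e : nat * seq int) : bool :=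
  let: (r, q) := e in let D := var_images (rootvec_comb q) in let Dx s := nth [::] D s.-1 in
  [&& [&& lroot q, all (fun x => 0 <= x) q & lnorm q == q],
      all (var_image_ok (rootvec_comb q)) (iota 1 26), all (cube_zero D) (iota 1 26),
      all (fun s => 0 < s <= 26)%N [:: p, r & Z] &
      [&& ccoef [:: p] (Dx r) != 0,
      meets Z [seq t <- Dx r | t.2 != [:: p]], meets Z (derive_poly D (Dx r)) &
      all (fun s => meets Z (Dx s) && meets Z (derive_poly D (Dx s))) (p :: Z)]].

Fixpoint moves_ok p Z l :=
  if l is e :: l' then move_ok p Z e && moves_ok p (e.1 :: Z) l' else true.

Section Data.
Local Open Scope nat_scope.
(** For x_r of weight mu, the root is lambda_4 - mu.  The height of mu does not increase
    with r, and this root sends a weight at least as high as mu out of the weights of V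
    unless it is mu itself: so the variables cleared before are sent to 0. *)
Definition x1_moves : seq (nat * seq int) :=
  [:: clears 2 [:: 0; 0; 0; 0; 0; 1]; clears 3 [:: 0; 0; 0; 0; 1; 1];
      clears 4 [:: 0; 0; 0; 1; 1; 1]; clears 5 [:: 0; 0; 1; 1; 1; 1];
      clears 6 [:: 0; 1; 0; 1; 1; 1]; clears 7 [:: 1; 0; 1; 1; 1; 1];
      clears 8 [:: 0; 1; 1; 1; 1; 1]; clears 9 [:: 1; 1; 1; 1; 1; 1];
      clears 10 [:: 0; 1; 1; 2; 1; 1]; clears 11 [:: 1; 1; 1; 2; 1; 1];
      clears 12 [:: 0; 1; 1; 2; 2; 1]; clears 14 [:: 1; 1; 1; 2; 2; 1];
      clears 16 [:: 1; 1; 2; 2; 2; 1]; clears 18 [:: 1; 1; 2; 3; 2; 1];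
      clears 20 [:: 1; 2; 2; 3; 2; 1]].

(** The Levi subalgebra of type B3 that fixes x_1 acts on the span of x_15, x_17, x_19,
    x_21, ..., x_25 by the spin representation, with highest weight vector x_15.  The
    moves follow the same pattern there; the lowest weight vector x_25 remains, since
    its weight does not differ from that of x_15 by a root. *)
Definition x15_moves : seq (nat * seq int) :=
  [:: clears 17 [:: 0; 0; 0; 0; 1; 0]; clears 19 [:: 0; 0; 0; 1; 1; 0];
      clears 21 [:: 0; 0; 1; 1; 1; 0]; clears 22 [:: 0; 1; 0; 1; 1; 0];
      clears 23 [:: 0; 1; 1; 1; 1; 0]; clears 24 [:: 0; 1; 1; 2; 1; 0]].
End Data.

Definition x1_zeros : seq nat := rev [seq e.1 | e <- x1_moves].

Lemma moves_check : moves_ok 1 [::] x1_moves && moves_ok 15 x1_zeros x15_moves.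
Proof. by vm_compute. Qed.

(** The image of p modulo the variables outside S. *)
Definition restrict (S : seq nat) (p : cpoly) : cpoly :=
  [seq t <- p | all (mem S) t.2].

Section Points.
Variable R : realType.
Local Notation C := R[i].
Local Notation label_vec := (@label_vec R).
Local Notation mon := (@mon R).
Implicit Types (v w : 'I_26 -> C).

Definition at_var v (r : nat) : C := v (inord r.-1).

Definition peval v (p : cpoly) : C :=
  \sum_(t <- p) t.1%:~R * \prod_(i <- t.2) at_var v i.

Lemma meval_lc v p : (lc mon p).@[v] = peval v p.
Proof.
rewrite /lc raddf_sum; apply: eq_bigr => t _; rewrite /= mevalZ; congr (_ * _).
elim: t.2 => [|i m IH]; first by rewrite mon_nil big_nil meval1.
by rewrite mon_cons mevalM IH big_cons mevalXU.
Qed.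

Lemma peval_meets v Z p : (forall s, s \in Z -> at_var v s = 0) -> meets Z p ->
  peval v p = 0.
Proof.
move=> vZ /allP pZ; rewrite /peval big_seq big1 // => t /pZ /hasP[s st sZ].
by rewrite (big_rem s st) /= vZ // mul0r mulr0.
Qed.

Lemma peval_pick v m p : peval v p =
  (ccoef m p)%:~R * \prod_(i <- m) at_var v i + peval v [seq t <- p | t.2 != m].
Proof.
rewrite /peval [LHS](bigID (fun t => t.2 == m)) /= big_filter; congr (_ + _).
rewrite ccoefE rmorph_sum mulr_suml; apply: eq_bigr => t /eqP <- //.
Qed.

Lemma peval_restrict v S p : var_range p ->
  (forall s, (0 < s <= 26)%N -> s \notin S -> at_var v s = 0) ->
  peval v p = peval v (restrict S p).
Proof.
move=> /allP pr vS; rewrite /peval big_filter [LHS](bigID (fun t => all (mem S) t.2)) /=.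
rewrite [X in _ + X]big_seq_cond [X in _ + X]big1 ?addr0 // => t /andP[/pr tr].
rewrite -has_predC => /hasP[s st sS].
by rewrite (big_rem s st) /= vS ?mul0r ?mulr0 //; apply: (allP tr).
Qed.

Lemma act_X_nth u s : (0 < s <= 26)%N -> all (var_image_ok u) (iota 1 26) ->
  act (lc label_vec u) (X R s) = lc mon (nth [::] (var_images u) s.-1).
Proof.
move=> sb ru; have si : s \in iota 1 26 by rewrite mem_iota.
rewrite act_X_image ?(allP ru) // (nth_map 0%N) ?size_iota; last by case: (s) sb.
by rewrite nth_iota ?add1n ?prednK //; case: (s) sb.
Qed.

Lemma var_range_images u s : (0 < s <= 26)%N -> var_range (nth [::] (var_images u) s.-1).
Proof.
move=> sb; rewrite (nth_map 0%N) ?size_iota; last by case: (s) sb.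
apply/allP => t; rewrite mem_filter => /andP[_ /mapP[j jb ->]].
by rewrite /= andbT; move: jb; rewrite mem_iota.
Qed.

Definition act_flow (u : E6 R) v (t : C) : 'I_26 -> C :=
  flow (fun r j => coord (xbasis R) j (bracket u (xbasis R)`_r)) v t.

Lemma act_flow_invariant u v t f : all (var_image_ok u) (iota 1 26) ->
  all (cube_zero (var_images u)) (iota 1 26) -> act (lc label_vec u) f = 0 ->
  f.@[act_flow (lc label_vec u) v t] = f.@[v].
Proof.
move=> ru /allP nil3 f0; apply: flow_invariant f0 => s.
rewrite -!actE; have -> : 'X_s = X R s.+1 by rewrite /X inord_val.
have sb : (0 < s.+1 <= 26)%N by case: (s).
have /andP[vr /nilP n3] := nil3 s.+1 ltac:(by rewrite mem_iota).
rewrite act_X_nth // act_lc_mon ?var_range_images // act_lc_mon //.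
by rewrite n3 lc_nil.
Qed.

Lemma at_act_flow u v t s : (0 < s <= 26)%N -> all (var_image_ok u) (iota 1 26) ->
  at_var (act_flow (lc label_vec u) v t) s =
  at_var v s + peval v (nth [::] (var_images u) s.-1) * t
  + peval v (derive_poly (var_images u) (nth [::] (var_images u) s.-1)) / 2 * t ^+ 2.
Proof.
move=> sb ru; rewrite {1}/at_var /act_flow /flow -!actE -/(X R s).
by rewrite (act_X_nth sb ru) (act_lc_mon _ (var_range_images _ sb) ru) !meval_lc.
Qed.

Lemma move_step p Z e : move_ok p Z e -> forall v,
  (forall s, s \in Z -> at_var v s = 0) -> at_var v p != 0 ->
  exists w, [/\ forall s, s \in e.1 :: Z -> at_var w s = 0, at_var w p = at_var v p &
    forall f, killed_by_positive f -> f.@[w] = f.@[v]].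
Proof.
case: e => r q; rewrite /move_ok => /and5P[/and3P[rq /allP q0 /eqP nq] ru nil3].
move=> /and3P[pb rb /allP Zb] /and4P[c0 mr m2r /allP mZ] v vZ vp.
set D := var_images (rootvec_comb q) in c0 mr m2r mZ.
(* The time at which x_r + t c x_p vanishes, c being the coefficient of x_p. *)
pose t := - at_var v r / (ccoef [:: p] (nth [::] D r.-1))%:~R / at_var v p.
pose w := act_flow (lc label_vec (rootvec_comb q)) v t.
have keep s : s \in p :: Z -> at_var w s = at_var v s.
  move=> sp; have /andP[m1 m2] := mZ s sp.
  rewrite at_act_flow //; last by move: sp; rewrite inE => /predU1P[->|/Zb].
  by rewrite (peval_meets vZ m1) (peval_meets vZ m2) !mul0r !addr0.
exists w; split.
- move=> s; rewrite inE => /predU1P[->|sZ]; last by rewrite keep ?vZ // inE sZ orbT.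
  rewrite at_act_flow // (peval_meets vZ m2r) (peval_pick _ [:: p]) (peval_meets vZ mr).
  rewrite big_seq1 /t mul0r mul0r !addr0.
  by field; rewrite vp intr_eq0 c0.
- by rewrite keep ?mem_head.
move=> f fk; apply: act_flow_invariant => //.
have rq1 : form (latt q) (latt q) == 2 by rewrite form_latt.
rewrite -pos_rootvecE //; apply: (fk (Root rq1)).
apply/forallP => i; rewrite /= mxE.
by have [/(mem_nth 0)/q0|/(nth_default 0) ->] := ltnP i (size q).
Qed.

Lemma moves_step p l Z : moves_ok p Z l -> forall v,
  (forall s, s \in Z -> at_var v s = 0) -> at_var v p != 0 ->
  exists w, [/\ forall s, s \in Z \/ s \in [seq e.1 | e <- l] -> at_var w s = 0,
    at_var w p = at_var v p & forall f, killed_by_positive f -> f.@[w] = f.@[v]].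
Proof.
elim: l Z => [|e l IH] Z /=.
  by move=> _ v vZ vp; exists v; split=> // s [/vZ|].
move=> /andP[/move_step e1 /IH e2] v vZ vp.
have [w [wZ wp fw]] := e1 v vZ vp.
have [|w' [wZ' wp' fw']] := e2 w wZ; first by rewrite wp.
exists w'; split=> [s||f fk]; last by rewrite fw' ?fw.
  rewrite inE => -[sZ|/predU1P[->|sl]]; apply: wZ'; rewrite ?inE ?sZ ?eqxx ?orbT;
  by [left|right].
by rewrite wp'.
Qed.

(** The second sequence of moves needs a nonzero x_15; after the first one vartheta is
    x_1^2 x_15, and it has kept its nonzero value. *)
Lemma to_slice v : at_var v 1 != 0 -> (vartheta R).@[v] != 0 ->
  exists w, (forall s, (0 < s <= 26)%N -> s \notin [:: 1; 13; 15; 25; 26]%N -> at_var w s = 0) /\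
    forall f, killed_by_positive f -> f.@[w] = f.@[v].
Proof.
move=> v1 th0; have /andP[ok1 ok2] := moves_check.
have [|w1 [w1Z w1p fw1]] := moves_step ok1 (v := v) _ v1; first by [].
have {}w1Z s : s \in x1_zeros -> at_var w1 s = 0.
  by rewrite mem_rev => sZ; apply: w1Z; right.
have th1 : (vartheta R).@[w1] = at_var w1 1 ^+ 2 * at_var w1 15.
  have vr : var_range vartheta_poly by [].
  rewrite varthetaE meval_lc.
  rewrite (peval_restrict (S := [seq s <- iota 1 26 | s \notin x1_zeros]) vr).
    have -> : restrict [seq s <- iota 1 26 | s \notin x1_zeros] vartheta_poly
              = [:: pterm 1 [:: 1; 1; 15]%N] by vm_compute.
    rewrite /peval big_seq1 !big_cons big_nil [(pterm _ _).1]/= mul1r mulr1.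
    by rewrite mulrA.
  move=> s sb; rewrite mem_filter mem_iota sb andbT negbK; exact: w1Z.
have thk : killed_by_positive (vartheta R).
  by rewrite varthetaE; apply: generator_polys_killed.
have w15 : at_var w1 15 != 0.
  by apply: contraNneq th0 => e; rewrite -(fw1 _ thk) th1 e mulr0.
have [w [wZ wp fw]] := moves_step ok2 w1Z w15.
exists w; split=> [s sb sS|f fk]; last by rewrite (fw f fk) (fw1 f fk).
apply: wZ; apply/orP.
have /allP /(_ s) : all (fun s => (s \notin [:: 1; 13; 15; 25; 26]%N) ==>
  (s \in x1_zeros) || (s \in [seq e.1 | e <- x15_moves])) (iota 1 26) by vm_compute.
by rewrite mem_iota sS; apply.
Qed.

Definition lookup (l : seq (nat * C)) (r : nat) : C :=
  (head (0%N, 0) [seq p <- l | p.1 == r]).2.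

Definition sparse l : 'I_26 -> C := fun i => lookup l i.+1.

Definition lookup_eval l (p : cpoly) : C :=
  \sum_(t <- p) t.1%:~R * \prod_(i <- t.2) lookup l i.

Lemma at_sparse l r : (0 < r <= 26)%N -> at_var (sparse l) r = lookup l r.
Proof. by move=> rb; rewrite /at_var /sparse inord_pred // prednK //; case/andP: rb. Qed.

Lemma peval_sparse l p : var_range p ->
  peval (sparse l) p = lookup_eval l (restrict [seq e.1 | e <- l] p).
Proof.
move=> pr; rewrite (peval_restrict (S := [seq e.1 | e <- l])) // => [|s sb sl].
  rewrite /peval /lookup_eval !big_seq; apply: eq_bigr => t.
  rewrite mem_filter => /andP[_ /(allP pr) /allP tr]; congr (_ * _).
  by rewrite !big_seq; apply: eq_bigr => i /tr/at_sparse.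
rewrite at_sparse // /lookup; case E: [seq e <- l | e.1 == s] => [//|e l'].
have : e \in [seq e <- l | e.1 == s] by rewrite E mem_head.
by rewrite mem_filter => /andP[/eqP es el]; case/mapP: sl; exists e.
Qed.
End Points.

(** * Values of the generators *)

Section RestrictedData.
Local Open Scope nat_scope.

Lemma restrict_slice :
  [seq restrict [:: 1; 13; 15; 25; 26] g | g <- generator_polys] =
  [:: [:: pterm 1 [:: 1]]; [:: pterm 2 [:: 1; 13]]; [:: pterm 1 [:: 1; 1; 15]];
      [:: pterm 3 [:: 1; 26]; nterm 1 [:: 13; 13]];
      [:: pterm 27 [:: 1; 15; 25]; pterm 18 [:: 1; 13; 26]; pterm 2 [:: 13; 13; 13]]].
Proof. by vm_compute. Qed.

Lemma restrict_vartheta0 :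
  [seq restrict [:: 1; 13; 21; 22; 26] g | g <- generator_polys] =
  [:: [:: pterm 1 [:: 1]]; [:: pterm 2 [:: 1; 13]]; [::];
      [:: pterm 3 [:: 1; 26]; nterm 1 [:: 13; 13]];
      [:: pterm 27 [:: 1; 21; 22]; pterm 18 [:: 1; 13; 26]; pterm 2 [:: 13; 13; 13]]].
Proof. by vm_compute. Qed.

Lemma restrict_x0 :
  [seq restrict [:: 2; 12; 25; 26] g | g <- generator_polys] =
  [:: [::]; [:: nterm 3 [:: 2; 12]]; [:: pterm 1 [:: 2; 2; 12]];
      [:: pterm 3 [:: 2; 25]]; [:: nterm 27 [:: 2; 12; 26]]].
Proof. by vm_compute. Qed.

End RestrictedData.

Definition ord5 (k : nat) : 'I_5 := inord k.

Lemma forall_ord5 (P : 'I_5 -> Prop) :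
  P (ord5 0) -> P (ord5 1) -> P (ord5 2) -> P (ord5 3) -> P (ord5 4) -> forall i, P i.
Proof.
move=> P0 P1 P2 P3 P4 i; rewrite -(inord_val i).
by case: i => -[|[|[|[|[|]]]]].
Qed.

Lemma ord5_eq j k : (j < 5)%N -> (k < 5)%N -> (ord5 j == ord5 k) = (j == k).
Proof. by move=> j5 k5; rewrite -val_eqE /= !inordK. Qed.

Section Main.
Variable R : realType.
Local Notation C := R[i].
Variable phi : {linear subvs_of (V26 R) -> {mpoly C[26]}}.
Hypothesis hphi : isom_onto_generated (zeta1 R) phi.
Local Notation gens := (generators phi).

Lemma gen_at v k : (k < 5)%N ->
  (tnth gens (ord5 k)).@[v] = peval v (nth [::] generator_polys k).
Proof. by move=> k5; rewrite (generatorsE hphi) meval_lc inordK. Qed.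

Lemma generator_polys_range k : (k < 5)%N -> var_range (nth [::] generator_polys k).
Proof.
by move=> k5; have /andP[/allP vr _] := killed_check; apply/vr/mem_nth.
Qed.

Lemma gen_sparse (l : seq (nat * C)) (k : nat) : (k < 5)%N ->
  (tnth gens (ord5 k)).@[sparse l] =
  lookup_eval l (nth [::] [seq restrict [seq e.1 | e <- l] g | g <- generator_polys] k).
Proof.
move=> k5; rewrite (gen_at _ k5) peval_sparse ?generator_polys_range //.
congr (lookup_eval l _); rewrite [RHS](nth_map [::]) //.
Qed.

(** The point of the slice at which the generators take the values c; the equations
    for x_1, x_13, x_15, x_26 and x_25 are solved in this order. *)
Definition slice (c : 'I_5 -> C) : seq (nat * C) :=
  let x1 := c (ord5 0) in
  let x13 := c (ord5 1) / (2 * x1) in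
  let x15 := c (ord5 2) / x1 ^+ 2 in
  let x26 := (c (ord5 3) + x13 ^+ 2) / (3 * x1) in
  let x25 := (c (ord5 4) - 18 * x1 * x13 * x26 - 2 * x13 ^+ 3) / (27 * x1 * x15) in
  [:: (1, x1); (13, x13); (15, x15); (25, x25); (26, x26)]%N.

Lemma gen_slice c : c (ord5 0) != 0 -> c (ord5 2) != 0 ->
  forall i, (tnth gens i).@[sparse (slice c)] = c i.
Proof.
move=> c0 c2; apply: forall_ord5; rewrite gen_sparse // restrict_slice;
  rewrite /lookup_eval /slice; cbn [nth]; rewrite !big_cons !big_nil /lookup /=;
  move: (c (ord5 0)) (c (ord5 1)) (c (ord5 2)) (c (ord5 3)) (c (ord5 4)) c0 c2 => x y z t u x0 z0;
  try (by field); try by field; rewrite x0.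
all: by field; rewrite x0 z0.
Qed.

Lemma reached_generic c : c (ord5 0) != 0 -> c (ord5 2) != 0 -> reached gens c.
Proof. by move=> c0 c2; exists (sparse (slice c)); apply: gen_slice. Qed.

(** With x_15 = 0, the product x_21 x_22 replaces x_15 x_25 in eta_2. *)
Lemma reached_vartheta0 c : c (ord5 2) = 0 -> c (ord5 0) != 0 -> reached gens c.
Proof.
move=> c2 c0.
pose x13 := c (ord5 1) / (2 * c (ord5 0)).
pose x26 := (c (ord5 3) + x13 ^+ 2) / (3 * c (ord5 0)).
pose x22 := (c (ord5 4) - 18 * c (ord5 0) * x13 * x26 - 2 * x13 ^+ 3) / (27 * c (ord5 0)).
exists (sparse [:: (1, c (ord5 0)); (13, x13); (21, 1%R); (22, x22); (26, x26)]%N).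
apply: forall_ord5; rewrite gen_sparse // restrict_vartheta0;
  rewrite /lookup_eval; cbn [nth]; rewrite ?big_cons !big_nil ?big_nil /lookup /= ?c2 //;
  rewrite /x22 /x26 /x13;
  move: (c (ord5 0)) (c (ord5 1)) (c (ord5 3)) (c (ord5 4)) c0 => x y t u x0;
  by field.
Qed.

(** With x_1 = 0, the values of zeta_1 = -3 x_2 x_12 and vartheta = x_2^2 x_12 fix x_2
    and x_12, then eta_1 = 3 x_2 x_25 fixes x_25 and eta_2 = -27 x_2 x_12 x_26 fixes
    x_26. *)
Lemma reached_x0 c : c (ord5 0) = 0 -> c (ord5 1) != 0 -> c (ord5 2) != 0 ->
  reached gens c.
Proof.
move=> c0 c1 c2.
pose x2 := - 3 * c (ord5 2) / c (ord5 1).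
pose x12 := c (ord5 1) ^+ 2 / (9 * c (ord5 2)).
pose x25 := - c (ord5 1) * c (ord5 3) / (9 * c (ord5 2)).
pose x26 := c (ord5 4) / (9 * c (ord5 1)).
exists (sparse [:: (2, x2); (12, x12); (25, x25); (26, x26)]%N).
apply: forall_ord5; rewrite gen_sparse // restrict_x0;
  rewrite /lookup_eval; cbn [nth]; rewrite ?big_cons !big_nil ?big_nil /lookup /= ?c0 //;
  rewrite /x26 /x25 /x12 /x2; move: (c (ord5 1)) (c (ord5 2)) (c (ord5 3)) (c (ord5 4)) c1 c2 => x y t u x0 y0;
  by field; rewrite ?x0 ?y0.
Qed.

Lemma slice_of_point w c :
  (forall s, (0 < s <= 26)%N -> s \notin [:: 1; 13; 15; 25; 26]%N -> at_var w s = 0) ->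
  at_var w 1 != 0 -> at_var w 15 != 0 -> (forall i, (tnth gens i).@[w] = c i) ->
  w =1 sparse (slice c).
Proof.
move=> wS; set x := at_var w 1; set d := at_var w 15 => x0 d0 gc.
pose l := [:: (1, x); (13, at_var w 13); (15, d); (25, at_var w 25); (26, at_var w 26)]%N.
have wl : w =1 sparse l.
  move=> i; have -> : w i = at_var w i.+1 by rewrite /at_var inord_val.
  rewrite /sparse /lookup.
  have [|iS] := boolP (i.+1 \in [:: 1; 13; 15; 25; 26]%N); last first.
    rewrite wS //; last by case: (i).
    by move: iS; rewrite /= !inE !negb_or => /and5P[/negPf i1 /negPf i2 /negPf i3 /negPf i4 /negPf i5];
      rewrite ![_ == i.+1]eq_sym i1 i2 i3 i4 i5.
  by rewrite !inE => /or4P[/eqP ->|/eqP ->|/eqP ->|/orP[/eqP ->|/eqP ->]].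
have gl k : (k < 5)%N -> c (ord5 k) =
    lookup_eval l (nth [::] [seq restrict [:: 1; 13; 15; 25; 26]%N g | g <- generator_polys] k).
  by move=> k5; rewrite -gc -(gen_sparse l k5) (meval_eq _ wl).
move=> i; rewrite wl; congr (sparse _ i); rewrite /slice !gl // restrict_slice.
rewrite /lookup_eval /l; cbn [nth]; rewrite !big_cons !big_nil /lookup /=.
clear gl wl l wS; clearbody x d.
move: (at_var w 13) (at_var w 25) (at_var w 26) => b e f.
by do !congr (_ :: _); congr (_, _); field; rewrite ?x0 ?d0.
Qed.

(** * Generation and algebraic independence *)

(** Laurent polynomials: polynomial up to inverses of the values of x_1 and
    vartheta. *)
Definition regular (f : ('I_5 -> C) -> C) :=
  exists (N : nat) (P : {mpoly C[5]}), forall c, c (ord5 0) != 0 -> c (ord5 2) != 0 ->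
    f c * (c (ord5 0) * c (ord5 2)) ^+ N = P.@[c].

Lemma regular_const a : regular (fun=> a).
Proof. by exists 0%N, a%:MP => c _ _; rewrite mevalC expr0 mulr1. Qed.

Lemma regular_coord i : regular (fun c => c i).
Proof. by exists 0%N, 'X_i => c _ _; rewrite mevalXU expr0 mulr1. Qed.

Lemma regularD f g : regular f -> regular g -> regular (fun c => f c + g c).
Proof.
move=> [N1 [P1 H1]] [N2 [P2 H2]].
exists (N1 + N2)%N,
  (P1 * ('X_(ord5 0) * 'X_(ord5 2)) ^+ N2 + P2 * ('X_(ord5 0) * 'X_(ord5 2)) ^+ N1) => c c0 c2.
rewrite mevalD !mevalM !rmorphXn /= !mevalM !mevalXU -H1 // -H2 // exprD.
by ring.
Qed.

Lemma regularM f g : regular f -> regular g -> regular (fun c => f c * g c).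
Proof.
move=> [N1 [P1 H1]] [N2 [P2 H2]]; exists (N1 + N2)%N, (P1 * P2) => c c0 c2.
by rewrite mevalM -H1 // -H2 // exprD; ring.
Qed.

Lemma regularX f n : regular f -> regular (fun c => f c ^+ n).
Proof.
move=> rf; elim: n => [|n IH]; first exact: regular_const.
have [N [P H]] := regularM rf IH.
by exists N, P => c c0 c2; rewrite exprS H.
Qed.

Lemma regularV0 : regular (fun c => (c (ord5 0))^-1).
Proof. by exists 1%N, 'X_(ord5 2) => c c0 c2; rewrite mevalXU expr1 mulKf. Qed.

Lemma regularV2 : regular (fun c => (c (ord5 2))^-1).
Proof. by exists 1%N, 'X_(ord5 0) => c c0 c2; rewrite mevalXU expr1 mulrC mulfK. Qed.

Lemma regular_ext f g : (forall c, c (ord5 0) != 0 -> c (ord5 2) != 0 -> f c = g c) ->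
  regular f -> regular g.
Proof. by move=> fg [N [P H]]; exists N, P => c c0 c2; rewrite -fg // H. Qed.

Lemma regular_slice r : regular (fun c => lookup (slice c) r).
Proof.
have r0 := regular_coord (ord5 0); have r1 := regular_coord (ord5 1).
have r2 := regular_coord (ord5 2); have r3 := regular_coord (ord5 3).
have r4 := regular_coord (ord5 4); have v0 := regularV0; have v2 := regularV2.
have r13 : regular (fun c => c (ord5 1) / (2 * c (ord5 0))).
  apply: regular_ext (regularM (regularM (regular_const 2^-1) r1) v0) => c c0 c2.
  by field.
have r26 : regular (fun c => (c (ord5 3) + (c (ord5 1) / (2 * c (ord5 0))) ^+ 2) / (3 * c (ord5 0))).
  apply: regular_ext
    (regularM (regularM (regular_const 3^-1) (regularD r3 (regularX 2 r13))) v0) => c c0 c2.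
  by field.
rewrite /lookup /slice /=.
case: (1%N == r) => /=; first exact: r0.
case: (13%N == r) => /=; first exact: r13.
case: (15%N == r) => /=.
  by apply: regular_ext (regularM r2 (regularX 2 v0)) => c c0 c2; rewrite exprVn.
case: (25%N == r) => /=.
  have e := regularD r4 (regularD
    (regularM (regularM (regularM (regular_const (- 18)) r0) r13) r26)
    (regularM (regular_const (- 2)) (regularX 3 r13))).
  apply: regular_ext (regularM (regularM (regularM (regular_const 27^-1) e) r0) v2) => c c0 c2.
  by field; rewrite c0 c2.
by case: (26%N == r); [exact: r26 | exact: regular_const].
Qed.

Lemma regular_restriction (f : {mpoly C[26]}) :
  regular (fun c => f.@[sparse (slice c)]).
Proof.
elim/mpoly_alg_ind: f => [a|i|f g rf rg|f g rf rg].
- by apply: regular_ext (regular_const a) => c _ _; rewrite mevalC.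
- by apply: regular_ext (regular_slice i.+1) => c _ _; rewrite mevalXU.
- by apply: regular_ext (regularD rf rg) => c _ _; rewrite mevalD.
by apply: regular_ext (regularM rf rg) => c _ _; rewrite mevalM.
Qed.

Lemma generator_neq0 i : tnth gens i != 0.
Proof.
have n1 := oner_neq0 C.
have [v Hv] := reached_generic (c := fun=> 1) n1 n1.
by apply: contraNneq n1 => g0; rewrite -(Hv i) g0 meval0.
Qed.

(** At a point where x_1 and vartheta do not vanish, f and the generators take the
    same values as at a point of the slice, and the latter is a regular function of
    the values of the generators. *)
Lemma localized_generation f : killed_by_positive f ->
  exists (N : nat) (P : {mpoly C[5]}),
    f * (tnth gens (ord5 0) * tnth gens (ord5 2)) ^+ N = P \mPo gens.
Proof.
move=> fk; have [N [P H]] := regular_restriction f; exists N, P.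
apply/eqP; rewrite -subr_eq0; apply/eqP.
apply: (mpoly_vanish_off (d := tnth gens (ord5 0) * tnth gens (ord5 2))).
  by rewrite mulf_neq0 ?generator_neq0.
move=> v; rewrite mevalM mulf_eq0 negb_or => /andP[v0 v2].
have v1 : at_var v 1 != 0.
  by move: v0; rewrite gen_at // /peval big_seq1 big_seq1 mul1r.
have vth : (vartheta R).@[v] != 0.
  by move: v2; rewrite gen_at // -meval_lc -varthetaE.
have [w [wS fw]] := to_slice v1 vth.
pose c i := (tnth gens i).@[v].
have cw i : (tnth gens i).@[w] = c i by apply/fw/generators_killed.
have w1 : at_var w 1 != 0.
  have := cw (ord5 0); rewrite /c !gen_at // /peval !big_seq1 !mul1r.
  by move=> ->.
have w15 : at_var w 15 != 0.
  have e2 := cw (ord5 2); apply: contraNneq v2 => e15; rewrite -[X in X == 0]e2.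
  rewrite gen_at // (peval_restrict (S := [:: 1; 13; 15; 25; 26]%N)) ?generator_polys_range //.
  rewrite -[restrict _ _](nth_map [::] [::] (restrict [:: 1; 13; 15; 25; 26]%N) (s := generator_polys)) //.
  by rewrite restrict_slice /peval big_seq1 !big_cons e15 mul0r !mulr0.
have c0 : c (ord5 0) != 0 := v0.
have c2 : c (ord5 2) != 0 := v2.
rewrite mevalB meval_comp mevalM rmorphXn /= mevalM -(fw f fk).
by rewrite (meval_eq _ (slice_of_point wS w1 w15 cw)) (H c c0 c2) subrr.
Qed.

Lemma generation f : killed_by_positive f -> exists P : {mpoly C[5]}, f = P \mPo gens.
Proof.
move=> /localized_generation[N]; elim: N => [|N IH] [P].
  by rewrite expr0 mulr1 => ->; exists P.
rewrite exprSr [f * _]mulrA; set h := f * _ => e.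
have {}e : tnth gens (ord5 0) * (tnth gens (ord5 2) * h) = P \mPo gens.
  by rewrite -e [LHS]mulrA [LHS]mulrC.
have [|P1 e1] := reached_div (generator_neq0 (ord5 0)) _ e.
  by move=> c c0 H; apply: reached_x0 => //; apply: H; rewrite ord5_eq.
have [|P2 e2] := reached_div (generator_neq0 (ord5 2)) _ e1.
  by move=> c c0 H; apply: reached_vartheta0 => //; apply: H; rewrite ord5_eq.
by apply: IH; exists P2.
Qed.

Lemma generators_indep (P : {mpoly C[5]}) : P \mPo gens = 0 -> P = 0.
Proof. by apply: reached_indep => c c0; apply: reached_generic. Qed.

End Main.

(** * Weights *)

Section CartanData.
Local Open Scope nat_scope.

Definition coroot_comb (i : nat) : comb label :=
  [seq (1%R, inl j) | j <- nth [::] [:: [:: 1]; [:: 3]; [:: 2; 4]; [:: 0; 5]] i.-1].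

(** The weights lambda_4, lambda_4, lambda_3, 0, 0 evaluated at the simple coroots;
    the default value covers the two invariants. *)
Definition gen_weight (k i : nat) : nat :=
  nth 0 (nth [::] [:: [:: 0; 0; 0; 1]; [:: 0; 0; 0; 1]; [:: 0; 0; 1; 0]] k) i.-1.
End CartanData.

Lemma weight_check :
  all (fun i => all (var_image_ok (coroot_comb i)) (iota 1 26) &&
    all (fun k => let g := nth [::] generator_polys k in
      nilp (collect (derive_poly (var_images (coroot_comb i)) g ++ cscale (- (gen_weight k i)%:Z) g)))
      (iota 0 5)) (iota 1 4).
Proof. by vm_compute. Qed.

Definition exponents : Type := (nat * nat * nat * nat * nat)%type.

Definition to_mnm (m : exponents) : 'X_{1..5} :=
  let: (m1, m2, m3, m4, m5) := m in
  [multinom nth 0%N [:: m1; m2; m3; m4; m5] i | i < 5].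

Definition of_mnm (m : 'X_{1..5}) : exponents :=
  (m (ord5 0), m (ord5 1), m (ord5 2), m (ord5 3), m (ord5 4)).

Lemma of_mnmK : cancel of_mnm to_mnm.
Proof.
by move=> m; apply/mnmP; apply: forall_ord5; rewrite mnmE inordK.
Qed.

Lemma to_mnmK : cancel to_mnm of_mnm.
Proof. by case=> [[[[m1 m2] m3] m4] m5]; rewrite /of_mnm !mnmE !inordK. Qed.

Section Weights.
Variable R : realType.
Local Notation C := R[i].
Local Notation label_vec := (@label_vec R).

Lemma corootE i : (0 < i <= 4)%N -> coroot R i = lc label_vec (coroot_comb i).
Proof.
rewrite /coroot /coroot_comb; case: i => [|[|[|[|[|i]]]]] // _;
  rewrite [_.-1]/= [nth _ _ _]/= [[seq _ | _ <- _]]/=.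
- by rewrite lc1.
- by rewrite lc1.
- by rewrite -(cat1s (1, inl 2%N)) lc_cat !lc1 inH_add.
by rewrite -(cat1s (1, inl 0%N)) lc_cat !lc1 inH_add.
Qed.

Lemma act_cartan (h : subvs_of (cartanF4 R)) f :
  act (vsval h) f = \sum_(k < 4) coord (coroots R) k (vsval h) *: act (coroot R k.+1) f.
Proof.
rewrite {1}(coord_span (subvsP h)) (linear_sum_at (act_linear_l f)).
by apply: eq_bigr => k _; rewrite -tnth_nth tnth_mktuple.
Qed.

Definition coroot_coord (i : nat) (h : subvs_of (cartanF4 R)) : C^o :=
  coord (coroots R) (inord i.-1) (vsval h).

Lemma coroot_coord_linear i : linear (coroot_coord i).
Proof. by move=> a u v; rewrite /coroot_coord !linearP. Qed.

HB.instance Definition _ i :=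
  GRing.isLinear.Build C (subvs_of (cartanF4 R)) C^o _ (coroot_coord i)
    (coroot_coord_linear i).

Lemma lambdaE i h : lambda R i h = coroot_coord i h.
Proof. exact: (lfunE (coroot_coord i : {linear _ -> _}) h). Qed.

Lemma weight_mulrn (mu : weight R) n h : (mu *+ n) h = mu h *+ n.
Proof.
elim: n => [|n IH]; first by rewrite !mulr0n lfunE.
by rewrite !mulrS add_lfunE IH.
Qed.

Definition monomial_weight (m : exponents) : weight R :=
  let: (m1, m2, m3, _, _) := m in lambda R 3 *+ m3 + lambda R 4 *+ (m1 + m2).

Variable phi : {linear subvs_of (V26 R) -> {mpoly C[26]}}.
Hypothesis hphi : isom_onto_generated (zeta1 R) phi.
Local Notation gens := (generators phi).

Lemma act_coroot_generator i k : (0 < i <= 4)%N -> (k < 5)%N ->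
  act (coroot R i) (tnth gens (ord5 k)) = (gen_weight k i)%:R *: tnth gens (ord5 k).
Proof.
move=> i4 k5; have /allP /(_ i) := weight_check; rewrite mem_iota => /(_ i4).
move=> /andP[ru /allP /(_ k)]; rewrite mem_iota => /(_ k5) /(lc_collect_eq0 (@mon R)).
rewrite lc_cat lc_scale rmorphN scaleNr => /eqP; rewrite subr_eq0 => /eqP e.
by rewrite corootE // (generatorsE hphi) inordK // act_lc_mon ?generator_polys_range //.
Qed.

Lemma eigenM (u : E6 R) a b f g : act u f = a *: f -> act u g = b *: g ->
  act u (f * g) = (a + b) *: (f * g).
Proof. by move=> ef eg; rewrite actM ef eg scalerDl -scalerAl -scalerAr. Qed.

Lemma eigenX (u : E6 R) a f n : act u f = a *: f -> act u (f ^+ n) = (a *+ n) *: f ^+ n.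
Proof.
move=> ef; elim: n => [|n IH]; first by rewrite expr0 act1 mulr0n scale0r.
by rewrite exprS mulrS (eigenM ef IH).
Qed.

Lemma generators_nth k : (k < 5)%N ->
  tnth gens (ord5 k) = nth 0 [:: X R 1; zeta1 R; vartheta R; eta1 R; eta2 phi] k.
Proof. by move=> k5; rewrite (tnth_nth 0) inordK. Qed.

Lemma act_coroot_monomial i m1 m2 m3 m4 m5 : (0 < i <= 4)%N ->
  act (coroot R i) (gen_monomial phi (m1, m2, m3, m4, m5)) =
  (if i == 3%N then m3%:R else if i == 4%N then (m1 + m2)%:R else 0) *:
  gen_monomial phi (m1, m2, m3, m4, m5).
Proof.
move=> i4; have w k (k5 : (k < 5)%N) := act_coroot_generator i4 k5.
have := eigenM (eigenM (eigenM (eigenM (eigenX m1 (w 0%N isT)) (eigenX m2 (w 1%N isT)))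
  (eigenX m3 (w 2%N isT))) (eigenX m4 (w 3%N isT))) (eigenX m5 (w 4%N isT)).
rewrite !generators_nth // [nth _ _ _]/= => ->; congr (_ *: _).
case: i i4 {w} => [|[|[|[|[|i]]]]] // _; rewrite /gen_weight /= ?mul0rn ?addr0 ?add0r //.
by rewrite natrD.
Qed.

Lemma act_cartan_monomial m h :
  act (vsval h) (gen_monomial phi m) = (monomial_weight m h : C) *: gen_monomial phi m.
Proof.
case: m => [[[[m1 m2] m3] m4] m5]; rewrite act_cartan !big_ord_recl big_ord0 /=.
rewrite !act_coroot_monomial //= !scale0r !scaler0 !add0r addr0 !scalerA -scalerDl.
congr (_ *: _); rewrite add_lfunE !weight_mulrn !lambdaE /coroot_coord !mulr_natr.
have -> : inord 3.-1 = lift ord0 (lift ord0 ord0) :> 'I_4.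
  by apply/val_inj; rewrite /= inordK.
have -> // : inord 4.-1 = lift ord0 (lift ord0 (lift ord0 ord0)) :> 'I_4.
by apply/val_inj; rewrite /= inordK.
Qed.

Lemma gen_monomialE m : gen_monomial phi m = 'X_[to_mnm m] \mPo gens.
Proof.
case: m => [[[[m1 m2] m3] m4] m5]; rewrite comp_mpolyX.
under eq_bigr do rewrite (tnth_nth 0) mnmE.
by rewrite !big_ord_recl big_ord0 /= mulr1 !mulrA.
Qed.

Lemma gen_monomial_indep : linearly_independent (gen_monomial phi).
Proof.
move=> s c us e i si.
have P0 : \sum_(j <- s) c j *: 'X_[to_mnm j] = 0 :> {mpoly C[5]}.
  apply: (generators_indep hphi); rewrite raddf_sum -[RHS]e.
  by apply: eq_bigr => j _; rewrite /= comp_mpolyZ gen_monomialE.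
have := congr1 (mcoeff (to_mnm i)) P0; rewrite mcoeff0 raddf_sum (bigD1_seq i) //=.
rewrite mcoeffZ mcoeffX eqxx mulr1 big1 ?addr0 // => j /negbTE ji.
by rewrite mcoeffZ mcoeffX (inj_eq (can_inj to_mnmK)) ji mulr0.
Qed.

Lemma gen_monomial_neq0 m : gen_monomial phi m != 0.
Proof.
apply/eqP => m0; have := @gen_monomial_indep [:: m] (fun=> 1) isT.
rewrite big_seq1 scale1r => /(_ m0 m (mem_head _ _)) /eqP.
by rewrite oner_eq0.
Qed.

Lemma killedM f g : killed_by_positive f -> killed_by_positive g ->
  @killed_by_positive R (f * g).
Proof. by move=> fk gk a ap; rewrite actM fk // gk // mul0r mulr0 addr0. Qed.

Lemma killedX f n : killed_by_positive f -> @killed_by_positive R (f ^+ n).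
Proof.
move=> fk; elim: n => [|n IH]; first by move=> a _; rewrite expr0 act1.
by rewrite exprS; apply: killedM.
Qed.

Lemma gen_monomial_singular m : singular_of_weight (monomial_weight m) (gen_monomial phi m).
Proof.
split; first by split; [exact: gen_monomial_neq0 | move=> h; exact: act_cartan_monomial].
have k i := generators_killed hphi i.
case: m => [[[[m1 m2] m3] m4] m5].
have := killedM (killedM (killedM (killedM (killedX m1 (k (ord5 0))) (killedX m2 (k (ord5 1))))
  (killedX m3 (k (ord5 2)))) (killedX m4 (k (ord5 3)))) (killedX m5 (k (ord5 4))).
by rewrite !generators_nth.
Qed.

Lemma comp_generatorsE (P : {mpoly C[5]}) :
  P \mPo gens = \sum_(m <- [seq of_mnm m | m <- msupp P])
    P@_(to_mnm m) *: gen_monomial phi m.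
Proof.
rewrite big_map {1}(mpolyE P) raddf_sum; apply: eq_bigr => m _.
by rewrite gen_monomialE of_mnmK; exact: comp_mpolyZ.
Qed.

(** Comparing h f = mu(h) f monomial by monomial, which linear independence allows,
    shows that every monomial occurring in f has weight mu. *)
Lemma singular_combination mu f : singular_of_weight mu f ->
  exists (s : seq exponents) (c : exponents -> C),
    (forall m, m \in s -> weight_vector mu (gen_monomial phi m)) /\
    f = \sum_(m <- s) c m *: gen_monomial phi m.
Proof.
move=> [[_ fmu] /(generation hphi)[P eP]].
exists [seq of_mnm m | m <- msupp P], (fun m => P@_(to_mnm m)).
split; last by rewrite eP comp_generatorsE.
set s := [seq _ | _ <- _]; have us : uniq s.
  by rewrite map_inj_uniq ?msupp_uniq //; exact: can_inj of_mnmK.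
move=> m ms; suff <- : monomial_weight m = mu by have [] := gen_monomial_singular m.
apply/lfunP => h; have cm : P@_(to_mnm m) != 0.
  by case/mapP: ms => m' m'P ->; rewrite of_mnmK -mcoeff_msupp.
have e : \sum_(j <- s) (P@_(to_mnm j) * ((monomial_weight j h : C) - mu h)) *: gen_monomial phi j = 0.
  have := fmu h; rewrite eP comp_generatorsE (linear_sum_at (act_linear _)).
  rewrite scaler_sumr => /eqP; rewrite -subr_eq0 -sumrB => /eqP s0; rewrite -[RHS]s0.
  apply: eq_bigr => j _; rewrite act_cartan_monomial !scalerA -scalerBl.
  by congr (_ *: _); ring.
have /eqP := gen_monomial_indep us e ms.
by rewrite mulf_eq0 (negbTE cm) subr_eq0 => /eqP.
Qed.
End Weights.

Theorem theorem3p1 (R : realType)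
    (phi : {linear subvs_of (V26 R) -> {mpoly R[i][26]}})
    (hphi : isom_onto_generated (zeta1 R) phi) :
  [/\ forall f : {mpoly R[i][26]}, killed_by_positive f ->
        exists p : {mpoly R[i][5]}, f = p \mPo generators phi,
      linearly_independent (gen_monomial phi),
      forall m1 m2 m3 m4 m5 : nat,
        singular_of_weight (lambda R 3 *+ m3 + lambda R 4 *+ (m1 + m2))
          (gen_monomial phi (m1, m2, m3, m4, m5)) &
      forall (mu : weight R) (f : {mpoly R[i][26]}), singular_of_weight mu f ->
        exists (s : seq (nat * nat * nat * nat * nat))
               (c : nat * nat * nat * nat * nat -> R[i]),
          (forall m, m \in s -> weight_vector mu (gen_monomial phi m)) /\
          f = \sum_(m <- s) c m *: gen_monomial phi m].
Proof.
split.
- exact: generation hphi.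
- exact: gen_monomial_indep hphi.
- by move=> m1 m2 m3 m4 m5; apply: (gen_monomial_singular hphi (m1, m2, m3, m4, m5)).
exact: singular_combination hphi.
Qed.
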